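(* Let $\mathcal{O}$ be a one-dimensional noetherian domain with field of fractions $K$ whose normalization $\tilde{\mathcal{O}}$ is finitely generated over $\mathcal{O}$. The canonical homomorphism $\mathrm{div}_{\mathcal{O}}\colon\mathcal{I}(\mathcal{O})\to\mathrm{Div}(\mathcal{O})$ is injective if and only if $\mathcal{O}=\tilde{\mathcal{O}}$.
   Context: The normalization $\tilde{\mathcal{O}}$ is the integral closure of $\mathcal{O}$ in $K$. $\mathbb{P}(\mathcal{O})$ is the set of maximal ideals of $\mathcal{O}$ and $\mathrm{Div}(\mathcal{O})$ is the free abelian group on $\mathbb{P}(\mathcal{O})$. For $\mathfrak{p}\in\mathbb{P}(\mathcal{O})$, $\mathcal{O}_\mathfrak{p}$ is the localization and $\mathrm{ord}_\mathfrak{p}\colon K^*\to\mathbb{Z}$ is the well-defined homomorphism $\frac{a}{b}\mapsto\mathrm{len}_{\mathcal{O}_\mathfrak{p}}(\mathcal{O}_\mathfrak{p}/a\mathcal{O}_\mathfrak{p})-\mathrm{len}_{\mathcal{O}_\mathfrak{p}}(\mathcal{O}_\mathfrak{p}/b\mathcal{O}_\mathfrak{p})$ (nonzero $a,b\in\mathcal{O}$), where $\mathrm{len}$ is composition length. $\mathcal{I}(\mathcal{O})$ is the group of invertible fractional ideals of $\mathcal{O}$. For $\mathfrak{a}\in\mathcal{I}(\mathcal{O})$ and $\mathfrak{p}\in\mathbb{P}(\mathcal{O})$ there is $a_\mathfrak{p}\in K^*$ with $\mathfrak{a}_\mathfrak{p}=a_\mathfrak{p}\mathcal{O}_\mathfrak{p}$,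 and $\mathrm{div}_{\mathcal{O}}(\mathfrak{a}):=\sum_\mathfrak{p}\mathrm{ord}_\mathfrak{p}(a_\mathfrak{p})\mathfrak{p}$. *)

(* Defs.v *)
From HB Require Import structures.
From mathcomp Require Import all_boot all_order all_algebra.
From mathcomp Require Import fraction ring_quotient generic_quotient.
From mathcomp Require Import boolp classical_sets fsbigop.
From mathcomp.multinomials Require Import freeg.

Set Implicit Arguments.
Unset Strict Implicit.
Unset Printing Implicit Defensive.

Import GRing.Theory.
Local Open Scope ring_scope.
Local Open Scope quotient_scope.

(* Subsets are boolean predicates, as in the closedness predicates of ssralg;
   with `[< >] every proposition defines one, so nothing is required to be
   decidable. *)

Section Modules.
Variables (R : pzRingType) (M : lmodType R).

Definition proper_subset (T : Type) (A B : {pred T}) : Prop :=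
  {subset A <= B} /\ ~ {subset B <= A}.

Definition fin_gen (S : {pred M}) : Prop :=
  exists n (v : 'I_n -> M),
    forall x, x \in S <-> exists c : 'I_n -> R, x = \sum_i c i *: v i.

Definition composition_series (n : nat) (s : nat -> {pred M}) : Prop :=
  [/\ s 0%N =i pred1 0,
      s n =i predT,
      (forall i, (i <= n)%N -> submod_closed (s i)) &
      (forall i, (i < n)%N -> proper_subset (s i) (s i.+1) /\
         (forall N : {pred M}, submod_closed N ->
            {subset s i <= N} -> {subset N <= s i.+1} ->
            N =i s i \/ N =i s i.+1))].

(* By Jordan-Hoelder all composition series have the same length; the value
   is 0 when there is none (module of infinite length). *)
Definition len : nat :=
  xget 0%N [set n | exists s, composition_series n s]%classic.

End Modules.

Arguments len {R} M.

Section QuotientModule.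
Variables (R : pzRingType) (M : lmodType R) (N : submodClosed M).

(* ssralg does not derive [zmodClosed] from [submodClosed]. *)
Definition submod_zmod : {pred M} := N.

HB.instance Definition _ := GRing.isZmodClosed.Build M submod_zmod
  (GRing.submod_closedB (submodClosedP N)).

Definition quotmod := {ideal_quot submod_zmod}.
Local Notation Q := quotmod.

HB.instance Definition _ := GRing.Zmodule.on Q.

Definition quotmod_pi (x : M) : Q := \pi_{ideal_quot submod_zmod} x.
Definition quotmod_scale (a : R) (x : Q) : Q :=
  quotmod_pi (a *: repr (x : {ideal_quot submod_zmod})).

Lemma quotmod_piP (x y : M) : quotmod_pi x = quotmod_pi y <-> x - y \in N.
Proof.
have -> : (x - y \in N) = (quotmod_pi x == quotmod_pi y).
  exact: (@Quotient.idealrBE _ submod_zmod).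
by split=> [->|/eqP].
Qed.

Lemma quotmod_piK (x : Q) : quotmod_pi (repr (x : {ideal_quot submod_zmod})) = x.
Proof. exact: reprK. Qed.

Lemma quotmod_piD (x y : M) :
  quotmod_pi (x + y) = quotmod_pi x + quotmod_pi y.
Proof. exact: (raddfD (\pi_{ideal_quot submod_zmod})). Qed.

Lemma quotmod_piZ a (x : M) :
  quotmod_pi (a *: x) = quotmod_scale a (quotmod_pi x).
Proof.
apply/quotmod_piP; rewrite -scalerBr; apply: (@rpredZ _ _ N).
by apply/quotmod_piP; rewrite quotmod_piK.
Qed.

Fact quotmod_scaleA a b x :
  quotmod_scale a (quotmod_scale b x) = quotmod_scale (a * b) x.
Proof. by rewrite -(quotmod_piK x) -!quotmod_piZ scalerA. Qed.

Fact quotmod_scale1 : left_id 1 quotmod_scale.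
Proof. by move=> x; rewrite -(quotmod_piK x) -!quotmod_piZ scale1r. Qed.

Fact quotmod_scaleDr : right_distributive quotmod_scale +%R.
Proof.
move=> a x y; rewrite -(quotmod_piK x) -(quotmod_piK y).
by rewrite -quotmod_piD -!quotmod_piZ scalerDr quotmod_piD.
Qed.

Fact quotmod_scaleDl x : {morph quotmod_scale^~ x : a b / a + b}.
Proof.
by move=> a b; rewrite -(quotmod_piK x) -!quotmod_piZ scalerDl quotmod_piD.
Qed.

HB.instance Definition _ := GRing.Zmodule_isLmodule.Build R Q
  quotmod_scaleA quotmod_scale1 quotmod_scaleDr quotmod_scaleDl.

End QuotientModule.

Section Rings.
Variable R : comNzRingType.

Definition noetherian : Prop :=
  forall I : {pred R^o}, submod_closed I -> fin_gen I.

(* [idealr_closed] includes properness. *)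
Definition prime_ideal (P : {pred R}) : Prop :=
  idealr_closed P /\ prime_idealr_closed P.

Definition maximal_ideal (P : {pred R}) : Prop :=
  idealr_closed P /\
  forall Q : {pred R}, idealr_closed Q -> {subset P <= Q} -> Q =i P.

Definition prime_chain (n : nat) (P : 'I_n.+1 -> {pred R}) : Prop :=
  (forall i, prime_ideal (P i)) /\
  (forall i j : 'I_n.+1, (i < j)%N -> proper_subset (P i) (P j)).

Definition has_krull_dim (d : nat) : Prop :=
  (exists P : 'I_d.+1 -> {pred R}, prime_chain P) /\
  (forall n (P : 'I_n.+1 -> {pred R}), prime_chain P -> (n <= d)%N).

Definition maxSpec := {P : R -> bool | `[< maximal_ideal P >]}.

HB.instance Definition _ := Choice.on maxSpec.

Lemma maxSpecP (p : maxSpec) : maximal_ideal (val p).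
Proof. by apply/asboolP; exact: (valP p). Qed.

Lemma maxSpec_prime (p : maxSpec) : prime_ideal (val p).
Proof.
have [pI pmax] := maxSpecP p; split=> // u v uvp.
have [p0 p1 pD] := pI.
have [//|unp] := boolP (u \in val p); rewrite orFb.
pose Q : {pred R} := [pred x | `[< exists2 y, y \in val p & exists a, x = a * u + y >]].
have QP x : reflect (exists2 y, y \in val p & exists a, x = a * u + y) (x \in Q).
  exact: asboolP.
have uQ : u \in Q by apply/QP; exists 0 => //; exists 1; rewrite mul1r addr0.
have pQ : {subset val p <= Q}.
  by move=> x xp; apply/QP; exists x => //; exists 0; rewrite mul0r add0r.
have Q1 : 1 \in Q.
  apply: contraT => nQ1.
  suff QI : idealr_closed Q by move: unp; rewrite -(pmax Q QI pQ) uQ.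
  split; [exact: pQ | exact: nQ1 | move=> a x y /QP[x' x'p [b ->]] /QP[y' y'p [c ->]]].
  apply/QP; exists (a * x' + y'); first exact: pD.
  by exists (a * b + c); rewrite mulrDr mulrDl mulrA addrACA.
have /QP[y yp [a e]] := Q1.
have -> : v = a * (u * v) + v * y by rewrite mulrA (mulrC v y) -mulrDl -e mul1r.
by rewrite (pD a) // -[v * y]addr0 (pD v).
Qed.

Lemma maxSpec1 (p : maxSpec) : 1 \notin val p.
Proof. by have [[]] := maxSpec_prime p. Qed.

Lemma maxSpecM (p : maxSpec) (s t : R) :
  s \notin val p -> t \notin val p -> s * t \notin val p.
Proof.
by move=> sp tp; apply/negP => /(maxSpec_prime p).2; rewrite (negPf sp) (negPf tp).
Qed.

End Rings.

Local Notation "x %:F" := (@FracField.tofrac _ x).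

Section Domain.
Variable O : idomainType.
Local Notation K := {fraction O}.

Definition fraction_scale (a : O) (x : K) : K := a%:F * x.

Fact fraction_scaleA a b x :
  fraction_scale a (fraction_scale b x) = fraction_scale (a * b) x.
Proof. by rewrite /fraction_scale rmorphM mulrA. Qed.

Fact fraction_scale1 : left_id 1 fraction_scale.
Proof. by move=> x; rewrite /fraction_scale rmorph1 mul1r. Qed.

Fact fraction_scaleDr : right_distributive fraction_scale +%R.
Proof. by move=> a x y; rewrite /fraction_scale mulrDr. Qed.

Fact fraction_scaleDl x : {morph fraction_scale^~ x : a b / a + b}.
Proof. by move=> a b; rewrite /fraction_scale rmorphD mulrDl. Qed.

HB.instance Definition _ := GRing.Zmodule_isLmodule.Build O K
  fraction_scaleA fraction_scale1 fraction_scaleDr fraction_scaleDl.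

Definition base_ring : {pred K} := [pred x | `[< exists a : O, x = a%:F >]].

Definition normalization : {pred K} :=
  [pred x | `[< integralOver (@FracField.tofrac O) x >]].

Definition loc_pred (p : maxSpec O) : {pred K} :=
  [pred x | `[< exists a s : O, s \notin val p /\ x = a%:F / s%:F >]].

Lemma tofrac_neq0 (p : maxSpec O) (s : O) : s \notin val p -> s%:F != 0 :> K.
Proof.
rewrite tofrac_eq0; apply: contraNneq => ->.
by have [[]] := maxSpec_prime p.
Qed.

Fact loc_subring_closed p : subring_closed (loc_pred p).
Proof.
split.
- apply/asboolP; exists 1, 1; split; first exact: maxSpec1.
  by rewrite rmorph1 divr1.
- move=> _ _ /asboolP[a [s [sp ->]]] /asboolP[b [t [tp ->]]]; apply/asboolP.
  exists (a * t - b * s), (s * t); split; first exact: maxSpecM.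
  rewrite rmorphB !rmorphM -[- (_ / _)]mulNr addf_div ?(tofrac_neq0 sp) ?(tofrac_neq0 tp) //.
  by rewrite mulNr.
- move=> _ _ /asboolP[a [s [sp ->]]] /asboolP[b [t [tp ->]]]; apply/asboolP.
  exists (a * b), (s * t); split; first exact: maxSpecM.
  by rewrite !rmorphM mulf_div.
Qed.

HB.instance Definition _ p :=
  GRing.isSubringClosed.Build K (loc_pred p) (loc_subring_closed p).

Record localization (p : maxSpec O) := Localization {
  loc_val : K;
  _ : loc_val \in loc_pred p
}.

HB.instance Definition _ p := [isSub for @loc_val p].
HB.instance Definition _ p := [Choice of localization p by <:].
HB.instance Definition _ p := [SubChoice_isSubComNzRing of localization p by <:].

Definition loc_principal (p : maxSpec O) (a : O) : {pred (localization p)^o} :=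
  [pred x : localization p |
     `[< exists r : localization p, val x = a%:F * val r >]].

Fact loc_principal_submod p a : submod_closed (@loc_principal p a).
Proof.
split; first by apply/asboolP; exists 0; rewrite !raddf0 mulr0.
move=> c x y /asboolP[r er] /asboolP[t et]; apply/asboolP.
exists (c * r + t : localization p).
rewrite [LHS](_ : _ = val c * val x + val y) // er et.
by rewrite !(raddfD, rmorphM) /= mulrDr mulrCA.
Qed.

HB.instance Definition _ p a :=
  GRing.isSubmodClosed.Build (localization p) (localization p)^o
    (@loc_principal p a) (@loc_principal_submod p a).

Definition len_loc_quot (p : maxSpec O) (a : O) : nat :=
  len (quotmod (@loc_principal p a)).

(* Only meant for x != 0; evaluated on the representative of x chosen by
   {fraction O}, the result does not depend on this choice. *)
Definition ord (p : maxSpec O) (x : K) : int :=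
  (len_loc_quot p (\n_(repr x)))%:Z - (len_loc_quot p (\d_(repr x)))%:Z.

Definition fractional_ideal (I : {pred K}) : Prop :=
  [/\ submod_closed I, fin_gen I & exists2 x, x \in I & x != 0].

Definition ideal_mul (I J : {pred K}) : {pred K} :=
  [pred x | `[< exists n (u v : 'I_n -> K),
     [/\ forall i, u i \in I, forall i, v i \in J & x = \sum_i u i * v i] >]].

Definition invertible_ideal (I : {pred K}) : Prop :=
  fractional_ideal I /\
  exists J, fractional_ideal J /\ ideal_mul I J =i base_ring.

Definition invIdeals := {I : K -> bool | `[< invertible_ideal I >]}.

Definition loc_ideal (p : maxSpec O) (I : {pred K}) : {pred K} :=
  [pred x | `[< exists y s, [/\ y \in I, s \notin val p & x = y / s%:F] >]].

(* A generator of I_p over O_p, unique up to a unit of O_p; it exists as soon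
   as I is invertible. *)
Definition loc_generator (p : maxSpec O) (I : {pred K}) : K :=
  xget 1 [set x | x != 0 /\
    forall y, y \in loc_ideal p I <-> exists2 r, r \in loc_pred p & y = x * r]%classic.

Definition Div := {freeg (maxSpec O) / int}.

(* The sum is over the support of its summand, which is finite when O is a
   one-dimensional noetherian domain. *)
Definition div (I : invIdeals) : Div :=
  \sum_(p \in [set: maxSpec O]%classic)
     << ord p (loc_generator p (val I)) *g p >>.

End Domain.

Arguments base_ring : clear implicits.
Arguments normalization : clear implicits.

(* Main.v *)
Require Import Defs.
From HB Require Import structures.
From mathcomp Require Import all_boot all_order all_algebra.
From mathcomp Require Import fraction ring_quotient generic_quotient.
From mathcomp Require Import boolp classical_sets cardinality fsbigop.
From mathcomp.multinomials Require Import freeg.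
From mathcomp Require Import zify ring.

(** Write A for the localization of O at a maximal ideal p.  Everything rests on
    one question: do two elements of K with the same order at p differ by a unit
    of A?  Since ord is a homomorphism, this asks whether [ord p x = 0] implies
    that x lies in A, for x nonzero.

    If O is normal, the answer is yes.  The determinant trick produces c in p
    such that p is contained in cA ([uniformizer]); if a and b in p have quotients
    A/aA and A/bA of the same length, dividing both by c shortens these equally,
    and an induction reaches the case where neither is in p ([ord_eq0_loc]).  An
    invertible ideal is locally principal ([invertible_generates]) and an ideal is
    recovered from its localizations ([local_global]), so the orders of the local
    generators determine the ideal.  They are the coefficients of its divisor
    because all but finitely many of them vanish ([finite_ord_generator]).

    Conversely, let div be injective.  For a nonzero in O, the contraction of aA
    to O is an invertible ideal ([primaryF_invertible]) that localizes to aA at p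
    and to the whole local ring at every other maximal ideal, so its divisor is
    ord_p(a) p.  Comparing these ideals for two elements a, b of the same order
    shows that the answer is yes at every p ([div_inj_ord]).  Then the group
    of nonzero elements of K modulo units of A embeds in the integers and is
    generated by some t of positive order.  Such a t lies in A
    ([uniformizer_loc]): large powers of t do, and writing 1 + t as a unit times
    a power of t shows that the exponent from which all powers are in A can always
    be lowered.  Hence A contains every element of nonnegative order and is integrally closed
    ([ord_valuation], [integral_loc]), and O is the intersection of these rings.

    That ord is a homomorphism is the Jordan-Hoelder theorem together with
    finiteness of the length of A/aA, which holds because A is noetherian and its
    nonzero primes are maximal ([jordan_holder], [finite_length],
    [len_loc_quotM]). *)

Set Implicit Arguments.
Unset Strict Implicit.
Unset Printing Implicit Defensive.

Import Order.TTheory GRing.Theory Num.Theory.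

Local Notation "x %:F" := (@FracField.tofrac _ x).

(** * Composition chains and the Jordan-Hoelder theorem *)

Section CompositionChains.
Local Open Scope ring_scope.
Variables (R : pzRingType) (M : lmodType R).
Implicit Types A B C D N : {pred M}.

Lemma eq_predP (T : Type) (A B : {pred T}) : A =i B -> A = B.
Proof. by move=> AB; apply: funext => x; have := AB x; rewrite !unfold_in. Qed.

Lemma subset_anti (T : Type) (A B : {pred T}) :
  {subset A <= B} -> {subset B <= A} -> A = B.
Proof. by move=> AB BA; apply: eq_predP => x; apply/idP/idP => [/AB|/BA]. Qed.

Lemma submodD A x y : submod_closed A -> x \in A -> y \in A -> x + y \in A.
Proof. by move=> [_ cA] xA yA; have := cA 1 x y xA yA; rewrite scale1r. Qed.

Lemma submodZ A a x : submod_closed A -> x \in A -> a *: x \in A.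
Proof. by move=> [A0 cA] xA; have := cA a x 0 xA A0; rewrite addr0. Qed.

Lemma submodB A x y : submod_closed A -> x \in A -> y \in A -> x - y \in A.
Proof.
by move=> cA xA yA; apply: submodD => //; rewrite -scaleN1r; apply: submodZ.
Qed.

Lemma submod_sum A (I : Type) (r : seq I) (P : pred I) (F : I -> M) :
  submod_closed A -> (forall i, F i \in A) -> \sum_(i <- r | P i) F i \in A.
Proof.
move=> cA FA; apply: (big_ind (fun x => x \in A)) => // [|x y]; first by case: cA.
exact: submodD.
Qed.

Definition join A B : {pred M} :=
  [pred x | `[< exists2 y, y \in A & exists2 z, z \in B & x = y + z >]].

Lemma joinP A B x :
  reflect (exists2 y, y \in A & exists2 z, z \in B & x = y + z) (x \in join A B).
Proof. exact: asboolP. Qed.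

Lemma joinC A B : join A B = join B A.
Proof.
by apply: subset_anti => x /joinP[y yA [z zB ->]]; apply/joinP;
  exists z => //; exists y => //; rewrite addrC.
Qed.

Lemma join_submod A B :
  submod_closed A -> submod_closed B -> submod_closed (join A B).
Proof.
move=> [A0 cA] [B0 cB]; split.
  by apply/joinP; exists 0 => //; exists 0 => //; rewrite addr0.
move=> a _ _ /joinP[y yA [z zB ->]] /joinP[y' yA' [z' zB' ->]]; apply/joinP.
exists (a *: y + y'); first exact: cA.
by exists (a *: z + z'); [exact: cB | rewrite scalerDr addrACA].
Qed.

Lemma join_subl A B : submod_closed B -> {subset A <= join A B}.
Proof.
by move=> [B0 _] x xA; apply/joinP; exists x => //; exists 0; rewrite ?addr0.
Qed.

Lemma join_subr A B : submod_closed A -> {subset B <= join A B}.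
Proof. by rewrite joinC; exact: join_subl. Qed.

Lemma join_min A B C : submod_closed C ->
  {subset A <= C} -> {subset B <= C} -> {subset join A B <= C}.
Proof.
by move=> cC sAC BC _ /joinP[y yA [z zB ->]]; apply: submodD; [|apply: sAC|apply: BC].
Qed.

Definition covers A C := [/\ submod_closed A, submod_closed C, proper_subset A C &
  forall N, submod_closed N -> {subset A <= N} -> {subset N <= C} -> N = A \/ N = C].

(** A composition series of B/A, given inductively so that proofs recurse on its
    first step instead of on an index, and between arbitrary submodules so that chains
    can be concatenated. *)
Inductive comp_chain : {pred M} -> {pred M} -> nat -> Prop :=
| Chain0 A : comp_chain A A 0
| ChainS A C B n : covers A C -> comp_chain C B n -> comp_chain A B n.+1.

Lemma chain_sub A B n : comp_chain A B n -> {subset A <= B}.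
Proof. by elim=> {A B n} [A x|A C B n [_ _ [sAC _] _] _ CB x /sAC/CB]. Qed.

Lemma chain_trivial A B n : comp_chain A B n -> {subset B <= A} -> n = 0%N.
Proof.
case=> {A B n} // A C B n [_ _ [_ nCA] _] /chain_sub CB BA.
by case: nCA => x /CB/BA.
Qed.

Lemma chain0_eq A B : comp_chain A B 0 -> A = B.
Proof.
by move: {-1}0%N (erefl 0%N) => n n0 h; case: h n0.
Qed.

Lemma chain_submod A B n :
  comp_chain A B n -> submod_closed A -> submod_closed B.
Proof. by elim=> {A B n} // A C B n [_ cC _ _] _ IH _; exact: IH. Qed.

Lemma chain_cat A B C n m :
  comp_chain A B n -> comp_chain B C m -> comp_chain A C (n + m).
Proof.
by elim=> {A B n} // A D B n AD _ IH BC; apply: (ChainS AD); exact: IH.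
Qed.

(** A submodule between C and C + D is determined by its intersection with D, which
    lies between A and D. *)
Lemma covers_join A C D : covers A C -> covers A D -> C <> D -> covers C (join C D).
Proof.
move=> [cA cC [sAC nCA] mC] [_ cD [AD nDA] mD] CD.
have nDC : ~ {subset D <= C}.
  by move=> DC; case: (mC D cD AD DC) => [DA|/esym//]; apply: nDA; rewrite DA.
split=> //; first exact: join_submod.
  split; first exact: join_subl.
  by move=> h; apply: nDC => x /(join_subr (A := C) cC)/h.
move=> N cN CN NJ.
pose ND : {pred M} := [pred x | (x \in N) && (x \in D)].
have cND : submod_closed ND.
  split; first by rewrite inE (proj1 cN) (proj1 cD).
  move=> a x y /andP[xN xD] /andP[yN yD].
  by rewrite inE (proj2 cN) // (proj2 cD).
have AND : {subset A <= ND} by move=> x xA; rewrite inE AD // CN ?sAC.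
have NDD : {subset ND <= D} by move=> x /andP[].
case: (mD ND cND AND NDD) => e.
- left; apply: subset_anti => // x xN.
  have /joinP[y yC [z zD xyz]] := NJ x xN.
  have zA : z \in A.
    by rewrite -e inE zD andbT -[z](addKr y) -xyz addrC submodB // CN.
  by rewrite xyz submodD // sAC.
- right; apply: subset_anti => //; apply: join_min => // x.
  by rewrite -e => /andP[].
Qed.

(** The exchange step: if the chain starts with D distinct from C, then C + D covers
    both, and a chain from C + D up to B continues the step from C to C + D. *)
Lemma chain_cut A B C n : comp_chain A B n -> covers A C -> {subset C <= B} ->
  exists2 m, n = m.+1 & comp_chain C B m.
Proof.
move=> AB; elim: AB C => {A B n} [A|A D B n AD DB IH] C sAC CB.
  by case: sAC => _ _ [_ nCA] _; case: nCA.
have [->|nCD] := pselect (C = D); first by exists n.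
have cB : submod_closed B by apply: chain_submod DB _; case: AD.
have [||m -> JB] := IH (join D C).
- by apply: (covers_join AD sAC) => /esym.
- exact: join_min (chain_sub DB) CB.
- by exists m.+1 => //; apply: ChainS JB; rewrite joinC; apply: (covers_join sAC AD).
Qed.

(** By [chain_cut], the second chain can be exchanged for one of the same length that
    begins with the first step of the first chain. *)
Theorem jordan_holder A B n m : comp_chain A B n -> comp_chain A B m -> n = m.
Proof.
move=> AB; elim: AB m => {A B n} [A|A C B n sAC CB IH] m h.
  by rewrite (chain_trivial h).
by have [k -> /IH->] := chain_cut h sAC (chain_sub CB).
Qed.

Lemma chain_of_series n s :
  @composition_series R M n s -> comp_chain (pred1 0 : {pred M}) predT n.
Proof.
move=> [/eq_predP <- /eq_predP <- cs hs].
elim: n => [|n IH] in s cs hs *; first exact: Chain0.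
apply: (@ChainS _ (s 1%N)).
  split; [exact: cs | exact: cs | exact: (hs 0%N _).1 | move=> N cN AN NC].
  by have [//|/eq_predP|/eq_predP] := (hs 0%N _).2 N cN AN NC; [left|right].
by apply: (IH (fun i => s i.+1)) => i h; [apply: (cs i.+1) | apply: (hs i.+1)].
Qed.

Lemma series_of_chain n :
  comp_chain (pred1 0 : {pred M}) predT n -> exists s, @composition_series R M n s.
Proof.
suff gen A B : comp_chain A B n -> submod_closed A ->
    exists s : nat -> {pred M}, [/\ s 0%N = A, s n = B,
      forall i, (i <= n)%N -> submod_closed (s i) &
      forall i, (i < n)%N -> covers (s i) (s i.+1)].
  move=> h; have [|s [s0 sn cs hs]] := gen _ _ h.
    split=> [|a x y]; first by rewrite !inE.
    by rewrite !inE => /eqP-> /eqP->; rewrite scaler0 addr0.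
  exists s; split=> [||//|i /hs[_ _ si mi]]; [by rewrite s0| by rewrite sn|].
  by split=> // N cN h1 h2; case: (mi N cN h1 h2) => ->; [left|right].
elim=> {A B n} [A cA|A C B n sAC _ IH cA]; first by exists (fun=> A); split.
have cC : submod_closed C by case: sAC.
have [s [s0 sn cs hs]] := IH cC.
exists (fun i => if i is j.+1 then s j else A).
by split=> // -[|i] h //=; [exact: cs | rewrite s0 | exact: hs].
Qed.

Lemma len_chain n : comp_chain (pred1 0 : {pred M}) predT n -> len M = n.
Proof.
move=> h; rewrite /len; case: xgetP => [m _ [s /chain_of_series hm]|ns].
  exact: jordan_holder hm h.
by have [s hs] := series_of_chain h; case: (ns n); exists s.
Qed.

End CompositionChains.

(** * Chains under linear maps *)

Section ChainImage.
Local Open Scope ring_scope.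
Variables (R : pzRingType) (M N : lmodType R) (f : M -> N).
Hypothesis lin_f : linear f.

Definition image_pred (A : {pred M}) : {pred N} :=
  [pred y | `[< exists2 x, x \in A & y = f x >]].

Lemma image_predP A y : reflect (exists2 x, x \in A & y = f x) (y \in image_pred A).
Proof. exact: asboolP. Qed.

Let fB x y : f (x - y) = f x - f y.
Proof. by rewrite addrC -scaleN1r lin_f scaleN1r addrC. Qed.

Let f0 : f 0 = 0.
Proof. by rewrite -(subrr 0) fB subrr. Qed.

Lemma image_submod A : submod_closed A -> submod_closed (image_pred A).
Proof.
move=> [A0 cA]; split; first by apply/image_predP; exists 0.
move=> a _ _ /image_predP[x xA ->] /image_predP[y yA ->]; apply/image_predP.
by exists (a *: x + y); [exact: cA | rewrite lin_f].
Qed.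

Lemma mem_image A x : submod_closed A -> (forall z, f z = 0 -> z \in A) ->
  (f x \in image_pred A) = (x \in A).
Proof.
move=> cA kA; apply/image_predP/idP => [[y yA fxy]|xA]; last by exists x.
by rewrite -[x](subrK y) submodD // kA // fB fxy subrr.
Qed.

(** A submodule between the images is the image of its preimage. It is enough that A
    contains the kernel, so this serves both for quotient maps and for multiplication
    by a nonzero element of a domain. *)
Lemma covers_image A C : (forall z, f z = 0 -> z \in A) ->
  covers A C -> covers (image_pred A) (image_pred C).
Proof.
move=> kA [cA cC [sAC nCA] mC].
have kC z : f z = 0 -> z \in C by move/kA/sAC.
split; [exact: image_submod | exact: image_submod | split |].
- by move=> _ /image_predP[x xA ->]; rewrite mem_image // sAC.
- by move=> h; apply: nCA => x xC; rewrite -(mem_image x cA kA) h // mem_image.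
move=> L cL AL LC.
pose P : {pred M} := [pred x | f x \in L].
have cP : submod_closed P.
  split=> [|a x y]; first by rewrite inE f0 (proj1 cL).
  by rewrite !inE lin_f => xL yL; exact: (proj2 cL).
have LE : L = image_pred P.
  apply: subset_anti => [y yL|_ /image_predP[x + ->]]; last by rewrite inE.
  have /image_predP[x xC yE] := LC y yL.
  by apply/image_predP; exists x; rewrite // inE -yE.
have AP : {subset A <= P} by move=> x xA; rewrite inE AL // mem_image.
have PC : {subset P <= C} by move=> x; rewrite inE => /LC; rewrite mem_image.
by case: (mC P cP AP PC) => PE; rewrite LE PE; [left|right].
Qed.

Lemma chain_image A B n : (forall z, f z = 0 -> z \in A) ->
  comp_chain A B n -> comp_chain (image_pred A) (image_pred B) n.
Proof.
move=> kA AB; elim: AB kA => {A B n} [A|A C B n sAC _ IH] kA; first exact: Chain0.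
apply: (ChainS (covers_image kA sAC)); apply: IH => z /kA.
by case: sAC => _ _ [sAC _] _ /sAC.
Qed.

End ChainImage.

Section QuotientLength.
Local Open Scope ring_scope.
Variables (R : pzRingType) (M : lmodType R) (N : submodClosed M).

Lemma len_quotmod n : comp_chain (N : {pred M}) predT n -> len (quotmod N) = n.
Proof.
have lin : linear (@quotmod_pi R M N).
  by move=> a x y; rewrite quotmod_piD quotmod_piZ.
have pi0 : quotmod_pi N 0 = 0.
  by apply: (addIr (quotmod_pi N 0)); rewrite -quotmod_piD addr0 add0r.
have piE x : (quotmod_pi N x == 0) = (x \in N).
  rewrite -[0]pi0; apply/eqP/idP => [/(quotmod_piP N)|xN]; first by rewrite subr0.
  by apply/(quotmod_piP N); rewrite subr0.
move=> h; apply: len_chain.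
have := chain_image lin _ h; set A := image_pred _ _; set B := image_pred _ _.
have -> : A = pred1 0.
  apply: subset_anti => [_ /image_predP[x xN ->]|y]; rewrite inE ?piE // => /eqP->.
  by apply/image_predP; exists 0; [exact: rpred0 | ].
have -> : B = predT.
  apply: subset_anti => // y _; apply/image_predP.
  by exists (repr (y : {ideal_quot submod_zmod N})); rewrite ?quotmod_piK.
by apply => z /eqP; rewrite piE.
Qed.

End QuotientLength.

(** * Ideals of noetherian rings *)

Section Ideals.
Local Open Scope ring_scope.
Variable R : comNzRingType.
Implicit Types (I J P : {pred R}) (x y : R).

Definition ideal I : Prop := @submod_closed R R^o I.

Lemma ideal0 I : ideal I -> 0 \in I. Proof. by case. Qed.

Lemma idealD I x y : ideal I -> x \in I -> y \in I -> x + y \in I.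
Proof. exact: submodD. Qed.

Lemma idealM I a x : ideal I -> x \in I -> a * x \in I.
Proof. exact: submodZ. Qed.

Lemma ideal_proper I : idealr_closed I <-> ideal I /\ 1 \notin I.
Proof.
split=> [[I0 I1 cI]|[[I0 cI] I1]]; first by split=> //; split.
by split=> // a x y; exact: cI.
Qed.

Lemma ideal_whole I x : ideal I -> 1 \in I -> x \in I.
Proof. by move=> cI I1; rewrite -[x]mulr1 idealM. Qed.

Definition adjoin I x : {pred R} :=
  [pred y | `[< exists2 i, i \in I & exists a, y = i + a * x >]].

Lemma adjoinP I x y :
  reflect (exists2 i, i \in I & exists a, y = i + a * x) (y \in adjoin I x).
Proof. exact: asboolP. Qed.

Lemma adjoin_ideal I x : ideal I -> ideal (adjoin I x).
Proof.
move=> cI; split.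
  by apply/adjoinP; exists 0; [exact: ideal0 | exists 0; rewrite mul0r addr0].
move=> a _ _ /adjoinP[i iI [b ->]] /adjoinP[j jI [c ->]]; apply/adjoinP.
exists (a * i + j); first by rewrite idealD ?idealM.
by exists (a * b + c); rewrite [LHS]/(a * _ + _) mulrDr mulrDl mulrA addrACA.
Qed.

Lemma sub_adjoin I x : {subset I <= adjoin I x}.
Proof. by move=> i iI; apply/adjoinP; exists i => //; exists 0; rewrite mul0r addr0. Qed.

Lemma mem_adjoin I x : ideal I -> x \in adjoin I x.
Proof.
by move=> /ideal0 I0; apply/adjoinP; exists 0 => //; exists 1; rewrite add0r mul1r.
Qed.

Definition colon I x : {pred R} := [pred r | r * x \in I].

Lemma colon_ideal I x : ideal I -> ideal (colon I x).
Proof.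
move=> cI; split=> [|a r s]; first by rewrite inE mul0r ideal0.
by rewrite !inE => rI sI; rewrite mulrDl -mulrA idealD // idealM.
Qed.

Lemma colon_sub I x : ideal I -> {subset I <= colon I x}.
Proof. by move=> cI i iI; rewrite inE mulrC idealM. Qed.

Lemma prime_idealI P : prime_ideal P -> ideal P /\ 1 \notin P.
Proof. by case=> /ideal_proper. Qed.

Lemma maximal_idealI P : maximal_ideal P -> ideal P /\ 1 \notin P.
Proof. by case=> /ideal_proper. Qed.

Lemma not_prime_ideal I : ideal I -> 1 \notin I -> ~ prime_ideal I ->
  exists u v, [/\ u * v \in I, u \notin I & v \notin I].
Proof.
move=> cI I1 np; apply: contrapT => nuv; apply: np.
split=> [|u v uvI]; first by apply/ideal_proper.
by apply: contraT; rewrite negb_or => /andP[uI vI]; case: nuv; exists u, v.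
Qed.

Lemma maximal_comax P r : maximal_ideal P -> r \notin P ->
  exists2 u, u \in P & exists v, 1 = u + v * r.
Proof.
move=> mP rP; have [cP _] := maximal_idealI mP.
apply/adjoinP; apply: contraT => n1.
have : idealr_closed (adjoin P r) by apply/ideal_proper; split=> //; exact: adjoin_ideal.
move=> /(mP.2 _) h; move: rP; rewrite -h ?mem_adjoin //; exact: sub_adjoin.
Qed.

Lemma maximal_eq P Q : maximal_ideal P -> ideal Q -> 1 \notin Q ->
  {subset P <= Q} -> Q = P.
Proof.
by move=> mP cQ Q1 PQ; apply: eq_predP; apply: mP.2 => //; apply/ideal_proper.
Qed.

Section Noetherian.
Hypothesis noethR : noetherian R.

Lemma ideal_generators I : ideal I -> exists n (v : 'I_n -> R),
  (forall i, v i \in I) /\ forall x, x \in I -> exists c, x = \sum_i c i * v i.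
Proof.
move=> cI; have [n [v vP]] := noethR cI; exists n, v.
split=> [i|x /vP//]; apply/vP; exists (fun j => (j == i)%:R).
by rewrite (bigD1 i) //= eqxx scale1r big1 ?addr0 // => j /negPf->; rewrite scale0r.
Qed.

(** If T failed at I, it would fail at a strictly larger ideal, and so on; the union of
    the resulting sequence is finitely generated, hence already reached at some stage. *)
Lemma noetherian_ind (T : {pred R} -> Prop) :
  (forall I, ideal I ->
     (forall J, ideal J -> {subset I <= J} -> ~ {subset J <= I} -> T J) -> T I) ->
  forall I, ideal I -> T I.
Proof.
move=> step I0 cI0; apply: contrapT => nT0.
pose bad := {I : {pred R} | ideal I /\ ~ T I}.
have /choice[f fP] (I : bad) : exists J : bad,
    {subset sval I <= sval J} /\ ~ {subset sval J <= sval I}.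
  case: I => I [cI nT] /=; apply: contrapT => nJ; apply: nT; apply: step => // J cJ IJ nJI.
  by apply: contrapT => nTJ; apply: nJ; exists (exist _ J (conj cJ nTJ)).
pose u n : {pred R} := sval (iter n f (exist _ I0 (conj cI0 nT0) : bad)).
have cu n : ideal (u n) by rewrite /u; case: (iter _ _ _) => I [].
have uS n : {subset u n <= u n.+1} by exact: (fP _).1.
have uM m n : (m <= n)%N -> {subset u m <= u n}.
  by move=> /subnKC <-; elim: (n - m)%N => [|k IH] x; rewrite ?addn0 ?addnS // => /IH/uS.
pose U : {pred R} := [pred x | `[< exists n, x \in u n >]].
have UP x : reflect (exists n, x \in u n) (x \in U) by exact: asboolP.
have cU : ideal U.
  split; first by apply/UP; exists 0%N; exact: ideal0.
  move=> a x y /UP[m xm] /UP[n yn]; apply/UP; exists (maxn m n).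
  rewrite (proj2 (cu _)) //; [apply: uM xm | apply: uM yn].
    exact: leq_maxl.
  exact: leq_maxr.
have [k [v [vU vP]]] := ideal_generators cU.
have /choice[N NP] (i : 'I_k) : exists n, v i \in u n by exact/UP.
apply: (fP (iter (\max_i N i) f (exist _ I0 (conj cI0 nT0)))).2 => x xu.
have /vP[c ->] : x \in U by apply/UP; exists (\max_i N i).+1.
apply: (@submod_sum _ R^o) => [|i]; first exact: (cu (\max_i N i)).
apply: (@submodZ _ R^o); first exact: (cu (\max_i N i)).
exact: uM (leq_bigmax i) _ (NP i).
Qed.

(** An ideal maximal among those disjoint from S is prime: when u v lies in I but u and
    v do not, both I + (u) and I + (v) meet S, and the product of the two common
    elements lies in I. *)
Lemma prime_avoiding (S : R -> Prop) I : S 1 ->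
  (forall s t, S s -> S t -> S (s * t)) -> ideal I -> (forall s, S s -> s \notin I) ->
  exists P, [/\ prime_ideal P, {subset I <= P} & forall s, S s -> s \notin P].
Proof.
move=> S1 SM; move: I; apply: noetherian_ind => I cI IH SI.
have [pI|] := pselect (prime_ideal I); first by exists I; split.
move=> /(not_prime_ideal cI (SI _ S1))[u [v [uvI uI vI]]].
have bigger w : w \notin I -> ~ {subset adjoin I w <= I}.
  by move=> wI h; move: wI; rewrite h // mem_adjoin.
have meet w : w \notin I ->
    (exists P, [/\ prime_ideal P, {subset I <= P} & forall s, S s -> s \notin P]) \/
    exists2 s, S s & s \in adjoin I w.
  move=> wI; have [h|h] := pselect (exists2 s, S s & s \in adjoin I w); first by right.
  left; have [||||P [pP wP SP]] := IH (adjoin I w).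
  - exact: adjoin_ideal.
  - exact: sub_adjoin.
  - exact: bigger.
  - by move=> s Ss; apply/negP => sw; apply: h; exists s.
  by exists P; split=> // x xI; apply/wP/sub_adjoin.
have [//|[s Ss /adjoinP[i iI [a sE]]]] := meet u uI.
have [//|[t St /adjoinP[j jI [b tE]]]] := meet v vI.
have /negP[] := SI _ (SM _ _ Ss St).
have -> : s * t = t * i + (a * u) * j + (a * b) * (u * v).
  by rewrite sE tE; ring.
by apply: (idealD cI); [apply: (idealD cI) |]; apply: (idealM _ cI).
Qed.

Lemma sub_maximal_prime I : ideal I -> 1 \notin I ->
  exists2 P, prime_ideal P & {subset I <= P}.
Proof.
move=> cI I1; have [||s ->//|P [pP IP _]] := @prime_avoiding (fun s => s = 1) I _ _ cI.
- by [].
- by move=> s t -> ->; rewrite mulr1.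
by exists P.
Qed.

(** Existence of an associated prime of R/I: a maximal colon ideal is prime, because
    u v in (I : x) with u not in (I : x) and v not in (I : x) makes
    (I : ux) strictly larger: it contains v. *)
Lemma prime_colon I x : ideal I -> x \notin I ->
  exists2 y, y \notin I & prime_ideal (colon I y).
Proof.
move=> cI; suff gen J : ideal J -> forall x, J = colon I x -> x \notin I ->
    exists2 y, y \notin I & prime_ideal (colon I y).
  exact: gen (colon_ideal x cI) x erefl.
move: J; apply: noetherian_ind => J cJ IH {}x JE xI.
have [pJ|] := pselect (prime_ideal (colon I x)); first by exists x.
move=> /(not_prime_ideal (colon_ideal x cI)); rewrite inE mul1r => /(_ xI)[u [v]].
rewrite !inE => -[uvI uI vI].
apply: (IH (colon I (u * x))) (erefl _) uI; first exact: colon_ideal.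
  by move=> r; rewrite JE !inE mulrCA => /(idealM u cI).
by move=> /(_ v); rewrite JE !inE mulrA [v * u]mulrC => /(_ uvI); exact/negP.
Qed.

Section ZeroDimensionalQuotient.
Variable I0 : {pred R}.
Hypothesis maxI0 : forall P, prime_ideal P -> {subset I0 <= P} -> maximal_ideal P.

(** If (I : x) is prime, hence maximal, then (I + (x))/I is isomorphic to R/(I : x), so
    I + (x) covers I. *)
Lemma finite_length : ideal I0 -> exists n, @comp_chain R R^o I0 predT n.
Proof.
move=> cI0; have: {subset I0 <= I0} by [].
move: {-2}I0 cI0; apply: noetherian_ind => I cI IH II0.
have [I1|I1] := boolP (1 \in I).
  exists 0%N; suff -> : I = predT by exact: Chain0.
  by apply: subset_anti => // x _; exact: ideal_whole.
have [x xI px] := prime_colon cI I1.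
have mx : maximal_ideal (colon I x).
  by apply: maxI0 => // y /II0; exact: colon_sub.
have cIx := adjoin_ideal x cI.
have nIx : ~ {subset adjoin I x <= I}.
  by move=> h; move: xI; rewrite h // mem_adjoin.
have [n hn] := IH _ cIx (@sub_adjoin I x) nIx (fun y yI => sub_adjoin x (II0 y yI)).
exists n.+1; apply: ChainS hn; split=> //; first by split=> //; exact: sub_adjoin.
move=> N cN IN NIx; have [NI|nNI] := pselect {subset N <= I}.
  by left; exact: subset_anti.
right; apply: subset_anti => //.
have [y yN yI] : exists2 y, y \in N & y \notin I.
  by apply: contrapT => h; apply: nNI => y yN; apply: contrapT => /negP yI; apply: h; exists y.
have /adjoinP[i iI [r yE]] := NIx y yN.
have rx : r \notin colon I x.
  by apply: contra yI; rewrite inE yE => rxI; rewrite idealD.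
have [u ux [v uv]] := maximal_comax mx rx.
have xN : x \in N.
  rewrite -[x]mul1r uv mulrDl -mulrA; apply: (@submodD _ R^o) => //; first exact: IN.
  apply: (@submodZ _ R^o) => //; have -> : r * x = y - i by rewrite yE addrC addKr.
  by apply: (@submodB _ R^o) => //; exact: IN.
move=> _ /adjoinP[j jI [a ->]]; apply: (@submodD _ R^o) => //; first exact: IN.
exact: (@submodZ _ R^o).
Qed.

(** If I is not prime, take u v in I with u and v outside: a maximal ideal over I
    contains I + (u) or I + (v). *)
Lemma finite_maximal_over : ideal I0 ->
  finite_set [set p : maxSpec R | {subset I0 <= val p}]%classic.
Proof.
move=> cI0; have: {subset I0 <= I0} by [].
move: {-2}I0 cI0; apply: noetherian_ind => I cI IH II0.
have [I1|I1] := boolP (1 \in I).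
  suff -> : [set p : maxSpec R | {subset I <= val p}]%classic = set0 by [].
  by rewrite -subset0 => p /= /(_ _ I1) p1; have := maxSpec1 p; rewrite p1.
have [pI|npI] := pselect (prime_ideal I).
  have mI := maxI0 pI II0.
  pose p0 : maxSpec R := exist _ I (asboolT mI).
  apply: (sub_finite_set _ (finite_set1 p0)) => p /= Ip; apply: val_inj.
  by have [cp p1] := maximal_idealI (maxSpecP p); exact: maximal_eq.
have [u [v [uvI uI vI]]] := not_prime_ideal cI I1 npI.
have fin w : w \notin I ->
    finite_set [set p : maxSpec R | {subset adjoin I w <= val p}]%classic.
  move=> wI; apply: IH; [exact: adjoin_ideal | exact: sub_adjoin | | ].
    by move=> h; move: wI; rewrite h // mem_adjoin.
  by move=> x /II0/sub_adjoin.
apply: (@sub_finite_set _ _ ([set p : maxSpec R | {subset adjoin I u <= val p}] `|`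
                             [set p : maxSpec R | {subset adjoin I v <= val p}])%classic);
  last by rewrite finite_setU; split; exact: fin.
move=> p /= Ip; have [cp _] := maximal_idealI (maxSpecP p).
have adjp w : w \in val p -> {subset adjoin I w <= val p}.
  by move=> wp _ /adjoinP[i /Ip iI [a ->]]; apply: (idealD cp) => //; exact: (idealM a cp).
by case/orP: ((maxSpec_prime p).2 u v (Ip _ uvI)) => /adjp; [left|right].
Qed.

End ZeroDimensionalQuotient.
End Noetherian.
End Ideals.

(** * Fractions and localizations *)

Section Fractions.
Local Open Scope ring_scope.
Local Open Scope quotient_scope.
Variable O : idomainType.

(** The order is defined through the chosen representative of a fraction; this relates
    that representative to an actual quotient. *)
Lemma frac_repr (x : {fraction O}) : x = (\n_(repr x))%:F / (\d_(repr x))%:F.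
Proof.
have d0 : (\d_(repr x))%:F != 0 :> {fraction O} by rewrite tofrac_eq0 denom_ratioP.
apply: (mulIf d0); rewrite divfK // -{1}[x]reprK; unlock FracField.tofrac.
rewrite -[LHS]FracField.pi_mul; apply/eqmodP; rewrite /= FracField.equivfE.
by rewrite /FracField.mulf !numden_Ratio ?mulf_neq0 ?oner_eq0 ?denom_ratioP // !mulr1 mulrC.
Qed.

Lemma fracP (x : {fraction O}) : exists a b, b != 0 /\ x = a%:F / b%:F.
Proof. by exists \n_(repr x), \d_(repr x); rewrite denom_ratioP -frac_repr. Qed.

End Fractions.

Section Localization.
Local Open Scope ring_scope.
Variables (O : idomainType) (p : maxSpec O).
Local Notation K := {fraction O}.
Local Notation Op := (localization p).

Lemma loc_predP (x : K) :
  reflect (exists a s, s \notin val p /\ x = a%:F / s%:F) (x \in loc_pred p).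
Proof. exact: asboolP. Qed.

Lemma tofrac_loc a : a%:F \in loc_pred p.
Proof. by apply/loc_predP; exists a, 1; rewrite maxSpec1 rmorph1 divr1. Qed.

Lemma loc_valM (x y : Op) : val (x * y) = val x * val y. Proof. by []. Qed.

Definition to_loc (a : O) : Op := Localization (tofrac_loc a).

Lemma to_locD a b : to_loc (a + b) = to_loc a + to_loc b.
Proof. by apply: val_inj; rewrite /= rmorphD. Qed.

Lemma to_locM a b : to_loc (a * b) = to_loc a * to_loc b.
Proof. by apply: val_inj; rewrite /= rmorphM. Qed.

Lemma to_loc0 : to_loc 0 = 0. Proof. by apply: val_inj; rewrite /= rmorph0. Qed.
Lemma to_loc1 : to_loc 1 = 1. Proof. by apply: val_inj; rewrite /= rmorph1. Qed.

Lemma to_loc_inj : injective to_loc.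
Proof. by move=> a b /(congr1 val) /= /eqP; rewrite tofrac_eq => /eqP. Qed.

Lemma to_loc_eq0 a : (to_loc a == 0) = (a == 0).
Proof. by rewrite -val_eqE /= tofrac_eq0. Qed.

Lemma to_loc_sum n (F : 'I_n -> O) : to_loc (\sum_i F i) = \sum_i to_loc (F i).
Proof. by apply: (big_morph _ to_locD to_loc0). Qed.

Lemma to_loc_unit s : s \notin val p -> exists t : Op, t * to_loc s = 1.
Proof.
move=> sp; have h : (s%:F)^-1 \in loc_pred p.
  by apply/loc_predP; exists 1, s; rewrite rmorph1 mul1r.
by exists (Localization h); apply: val_inj; rewrite /= mulVf ?(tofrac_neq0 sp).
Qed.

Lemma loc_numerator (x : Op) : exists a s, s \notin val p /\ to_loc s * x = to_loc a.
Proof.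
have /loc_predP[a [s [sp xE]]] := valP x; exists a, s; split=> //.
by apply: val_inj; rewrite loc_valM xE mulrC divfK ?(tofrac_neq0 sp).
Qed.

Lemma loc_mulf_eq0 (x y : Op) : x * y = 0 -> x != 0 -> y = 0.
Proof.
move=> /(congr1 val) /eqP; rewrite loc_valM mulf_eq0.
by case/orP=> [/eqP h /eqP[]|/eqP h _]; apply: val_inj.
Qed.

Definition contraction (I : {pred Op}) : {pred O} := [pred a | to_loc a \in I].

Lemma contraction_ideal I : ideal I -> ideal (contraction I).
Proof.
move=> cI; split; first by rewrite inE to_loc0 ideal0.
move=> a x y; rewrite !inE to_locD to_locM => xI yI.
by apply: (idealD cI) => //; exact: (idealM _ cI).
Qed.

Lemma mem_contraction I x : ideal I ->
  x \in I -> exists a s, [/\ s \notin val p, to_loc s * x = to_loc a & a \in contraction I].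
Proof.
move=> cI xI; have [a [s [sp e]]] := loc_numerator x; exists a, s; split=> //.
by rewrite inE -e; exact: (idealM _ cI).
Qed.

Lemma contraction_sub I : ideal I -> 1 \notin I -> {subset contraction I <= val p}.
Proof.
move=> cI I1 s sI; apply: contraT => /to_loc_unit[t ts].
by rewrite -ts in I1; case/negP: I1; exact: (idealM _ cI).
Qed.

Lemma loc_noetherian : noetherian O -> noetherian Op.
Proof.
move=> noethO I cI; have [n [v [vI vP]]] := ideal_generators noethO (contraction_ideal cI).
exists n, (fun i => to_loc (v i)) => x; split=> [/(mem_contraction cI)|[c ->]].
  move=> [a [s [sp sx /vP[c aE]]]]; have [t ts] := to_loc_unit sp.
  exists (fun i => t * to_loc (c i)).
  rewrite -[LHS]mul1r -ts -mulrA sx aE to_loc_sum mulr_sumr.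
  by apply: eq_bigr => i _; rewrite to_locM mulrA.
by apply: (@submod_sum Op Op^o I) => // i; apply: (@submodZ Op Op^o I) => //; exact: vI.
Qed.

End Localization.

(** * Lengths over one-dimensional local rings *)

Section OneDimensional.
Local Open Scope ring_scope.
Variable O : idomainType.
Hypotheses (hdim : has_krull_dim O 1) (noethO : noetherian O).
Local Notation K := {fraction O}.

Lemma nonzero_prime_maximal (P : {pred O}) a :
  prime_ideal P -> a \in P -> a != 0 -> maximal_ideal P.
Proof.
move=> pP aP a0; split; first by case: pP.
move=> Q /ideal_proper[cQ Q1] PQ.
have [Q' pQ' QQ'] := sub_maximal_prime noethO cQ Q1.
suff Q'P : {subset Q' <= P} by move=> x; apply/idP/idP => [/QQ'/Q'P|/PQ].
apply: contrapT => nQ'P.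
(* a prime strictly above P would give the chain 0 < P < Q' *)
pose c (i : 'I_3) : {pred O} := if i == 0%N :> nat then (pred1 0 : {pred O}) else
  if i == 1%N :> nat then P else Q'.
suff : prime_chain c by move=> /(hdim.2).
have p0 : prime_ideal (pred1 0 : {pred O}).
  split; last by move=> u v; rewrite !inE mulf_eq0.
  split; rewrite ?inE ?eqxx ?oner_eq0 // => b x y; rewrite !inE => /eqP-> /eqP->.
  by rewrite mulr0 addr0.
split=> [[[|[|i]] hi] //|[[|[|i]] hi] [[|[|j]] hj]]; rewrite /c //= => ij.
- split=> [x|/(_ a aP)]; last by rewrite inE (negPf a0).
  by rewrite inE => /eqP->; case: pP => -[].
- split=> [x|/(_ a (QQ' _ (PQ _ aP)))]; last by rewrite inE (negPf a0).
  by rewrite inE => /eqP->; case: pQ' => -[].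
- by split=> // x /PQ/QQ'.
- by move: hj ij; rewrite !ltnS leqn0 => /eqP->.
Qed.

Lemma sub_maximal (I : {pred O}) a : ideal I -> 1 \notin I -> a \in I -> a != 0 ->
  exists p : maxSpec O, {subset I <= val p}.
Proof.
move=> cI I1 aI a0; have [P pP IP] := sub_maximal_prime noethO cI I1.
by exists (exist _ P (asboolT (nonzero_prime_maximal pP (IP _ aI) a0))).
Qed.

Section AtPrime.
Variable p : maxSpec O.
Local Notation Op := (localization p).
Local Notation L := (len_loc_quot p).

Lemma loc_prime_contraction (P : {pred Op}) x :
  prime_ideal P -> x \in P -> x != 0 -> contraction P = val p.
Proof.
move=> pP xP x0; have [cP P1] := prime_idealI pP.
have [a [s [sp sx aP]]] := mem_contraction cP xP.
have a0 : a != 0.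
  rewrite -(to_loc_eq0 p) -sx; apply/negP => /eqP/loc_mulf_eq0 h.
  have s0 : to_loc p s != 0 by rewrite to_loc_eq0 -tofrac_eq0 (tofrac_neq0 sp).
  by rewrite (h s0) eqxx in x0.
have pPc : prime_ideal (contraction P).
  split=> [|u v]; last by rewrite !inE to_locM; exact: pP.2.
  by apply/ideal_proper; split; [exact: contraction_ideal | rewrite inE to_loc1].
have [cp p1] := maximal_idealI (maxSpecP p).
by rewrite (maximal_eq (nonzero_prime_maximal pPc aP a0) cp p1 (contraction_sub cP P1)).
Qed.

Lemma loc_prime_maximal (P : {pred Op}) x :
  prime_ideal P -> x \in P -> x != 0 -> maximal_ideal P.
Proof.
move=> pP xP x0; have [cP P1] := prime_idealI pP.
split; first by case: pP.
move=> Q /ideal_proper[cQ Q1] PQ y; apply/idP/idP => [yQ|/PQ//].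
have [b [t [tp ty bQ]]] := mem_contraction cQ yQ.
have bP : to_loc p b \in P.
  suff : b \in contraction P by [].
  by rewrite (loc_prime_contraction pP xP x0); exact: contraction_sub cQ Q1 _ bQ.
have [u ut] := to_loc_unit tp.
by rewrite -[y]mul1r -ut -mulrA ty; exact: (idealM _ cP).
Qed.

Lemma loc_principalP a (x : Op) :
  reflect (exists r, x = to_loc p a * r) (x \in @loc_principal O p a).
Proof.
apply: (iffP (asboolP _)) => -[r e]; exists r; first exact: val_inj.
by rewrite e.
Qed.

Lemma loc_length a : a != 0 -> @comp_chain Op Op^o (@loc_principal O p a) predT (L a).
Proof.
move=> a0; have [||n hn] := @finite_length Op (loc_noetherian noethO) (@loc_principal O p a).
- move=> P pP aP; apply: (@loc_prime_maximal P (to_loc p a)) => //.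
    by apply: aP; apply/loc_principalP; exists 1; rewrite mulr1.
  by rewrite to_loc_eq0.
- exact: loc_principal_submod.
by have -> : L a = n by exact: len_quotmod.
Qed.

(** Multiplication by a carries a chain from bA to A onto one from abA to aA, which
    continues by a chain from aA to A. *)
Lemma len_loc_quotM a b : a != 0 -> b != 0 -> L (a * b) = (L a + L b)%N.
Proof.
move=> a0 b0; pose f (x : Op^o) : Op^o := to_loc p a * x.
have lin_f : linear f.
  by move=> c x y; rewrite /f mulrDr; congr (_ + _); rewrite [LHS]mulrCA.
have kf z : f z = 0 -> z \in @loc_principal O p b.
  move=> /loc_mulf_eq0 ->; first exact: (ideal0 (loc_principal_submod p b)).
  by rewrite to_loc_eq0.
have := chain_image lin_f kf (loc_length b0).
have -> : image_pred f (@loc_principal O p b) = @loc_principal O p (a * b).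
  apply: subset_anti => [_ /image_predP[x /loc_principalP[r ->] ->]|_ /loc_principalP[r ->]].
    by apply/loc_principalP; exists r; rewrite to_locM /f mulrA.
  apply/image_predP; exists (to_loc p b * r); first by apply/loc_principalP; exists r.
  by rewrite /f to_locM mulrA.
have -> : image_pred f predT = @loc_principal O p a.
  apply: subset_anti => [_ /image_predP[x _ ->]|_ /loc_principalP[r ->]].
    by apply/loc_principalP; exists x.
  by apply/image_predP; exists r.
move=> /chain_cat/(_ (loc_length a0)) h.
by rewrite addnC; apply: jordan_holder h; exact: loc_length (mulf_neq0 a0 b0).
Qed.

Lemma len_loc_quot_eq0 a : a != 0 -> (L a == 0%N) = (a \notin val p).
Proof.
move=> a0; apply/eqP/idP => [L0|ap].
  have := loc_length a0; rewrite L0 => h.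
  have cI : ideal (@loc_principal O p a) by exact: loc_principal_submod.
  have /loc_principalP[r r1] : 1 \in @loc_principal O p a by rewrite (chain0_eq h).
  have [b [s [sp sr]]] := loc_numerator r.
  apply: contra sp => ap; suff -> : s = b * a.
    by have [cp _] := maximal_idealI (maxSpecP p); exact: (idealM b cp).
  by apply: (@to_loc_inj _ p); rewrite to_locM -sr -mulrA [r * _]mulrC -r1 mulr1.
have [t ts] := to_loc_unit ap.
apply: (chain_trivial (loc_length a0)) => x _.
by apply/loc_principalP; exists (t * x); rewrite mulrCA mulrA ts mul1r.
Qed.

End AtPrime.
End OneDimensional.

(** * The order homomorphism *)

Section Order.
Local Open Scope ring_scope.
Variable O : idomainType.
Hypotheses (hdim : has_krull_dim O 1) (noethO : noetherian O).
Variable p : maxSpec O.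
Local Notation K := {fraction O}.
Local Notation Op := (localization p).
Local Notation L := (len_loc_quot p).
Local Notation A := (loc_pred p).
Implicit Types x y : K.

Lemma maxSpec_nonzero : exists2 a, a \in val p & a != 0.
Proof.
have [[P [pP PP]] _] := hdim; apply: contrapT => np.
have p0 a : a \in val p -> a = 0.
  by move=> ap; apply: contrapT => /eqP a0; apply: np; exists a.
have [_ []] := PP ord0 ord_max isT.
have [c1 P1] := prime_idealI (pP ord_max); have [c0 _] := prime_idealI (pP ord0).
rewrite (maximal_eq (maxSpecP p) c1 P1) => a.
  by move/p0->; exact: ideal0.
by move/p0->; exact: ideal0.
Qed.

(** Two representatives of one fraction have equal cross products, so additivity of the
    length makes the value independent of the representative. *)
Lemma ord_frac a b : a != 0 -> b != 0 ->
  ord p (a%:F / b%:F) = (L a)%:Z - (L b)%:Z.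
Proof.
move=> a0 b0; rewrite /ord; set x := _ / _.
have xE : x = (\n_(repr x))%:F / (\d_(repr x))%:F by exact: frac_repr.
have d0 := denom_ratioP (repr x).
have n0 : \n_(repr x) != 0.
  apply/eqP => n0; move/eqP: xE.
  by rewrite n0 rmorph0 mul0r mulf_eq0 invr_eq0 !tofrac_eq0 (negPf a0) (negPf b0).
have e : a * \d_(repr x) = \n_(repr x) * b.
  apply/eqP; rewrite -tofrac_eq !rmorphM /= -eqr_div ?tofrac_eq0 //; exact/eqP.
have := len_loc_quotM hdim noethO p a0 d0; rewrite e (len_loc_quotM hdim noethO) //.
lia.
Qed.

Lemma ordM x y : x != 0 -> y != 0 -> ord p (x * y) = ord p x + ord p y.
Proof.
have [a [b [b0 ->]]] := fracP x; have [c [d [d0 ->]]] := fracP y.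
rewrite !mulf_eq0 !invr_eq0 !tofrac_eq0 !negb_or => /andP[a0 _] /andP[c0 _].
rewrite mulf_div -!rmorphM !ord_frac ?mulf_neq0 // !(len_loc_quotM hdim noethO) //; lia.
Qed.

Lemma ord_one : ord p 1 = 0.
Proof. by apply: (addrI (ord p 1)); rewrite addr0 -ordM ?oner_neq0 ?mulr1. Qed.

Lemma ordV x : x != 0 -> ord p x^-1 = - ord p x.
Proof.
move=> x0; have := ordM x0 (invr_neq0 x0); rewrite divff // ord_one; lia.
Qed.

Lemma ord_expr x n : x != 0 -> ord p (x ^+ n) = ord p x * n%:Z.
Proof.
move=> x0; elim: n => [|n IH]; first by rewrite expr0 ord_one mulr0.
by rewrite exprS ordM ?expf_neq0 // IH; lia.
Qed.

Lemma ord_exprz x (n : int) : x != 0 -> ord p (x ^ n) = ord p x * n.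
Proof.
move=> x0; case: n => n; first exact: ord_expr.
by rewrite NegzE -exprnN ordV ?expf_neq0 // ord_expr // mulrN.
Qed.

Lemma ord_tofrac a : a != 0 -> ord p a%:F = (L a)%:Z.
Proof.
move=> a0; rewrite -[_%:F]divr1 -(rmorph1 (@FracField.tofrac O)) ord_frac ?oner_eq0 //.
have /eqP -> : L 1 == 0%N by rewrite (len_loc_quot_eq0 hdim noethO) ?oner_eq0 ?maxSpec1.
by rewrite subr0.
Qed.

Lemma ord_tofrac_gt0 a : a \in val p -> a != 0 -> 0 < ord p a%:F.
Proof.
move=> ap a0; rewrite ord_tofrac // ltz_nat lt0n (len_loc_quot_eq0 hdim noethO) //.
by rewrite negbK.
Qed.

Lemma loc_ord x : x \in A -> x != 0 -> exists a s,
  [/\ s \notin val p, a != 0, x = a%:F / s%:F & ord p x = (L a)%:Z].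
Proof.
move=> /loc_predP[a [s [sp ->]]]; rewrite mulf_eq0 negb_or tofrac_eq0 => /andP[a0 s0].
rewrite invr_eq0 tofrac_eq0 in s0; exists a, s; split=> //.
have /eqP Ls : L s == 0%N by rewrite (len_loc_quot_eq0 hdim noethO).
by rewrite ord_frac // Ls subr0.
Qed.

Lemma ord_ge0 x : x \in A -> x != 0 -> 0 <= ord p x.
Proof. by move=> xA /(loc_ord xA)[a [s [_ _ _ ->]]]. Qed.

Lemma loc_inv x : x \in A -> x != 0 -> ord p x = 0 -> x^-1 \in A.
Proof.
move=> xA /(loc_ord xA)[a [s [sp a0 -> ->]]] /eqP.
rewrite eqz_nat (len_loc_quot_eq0 hdim noethO) // => ap.
by apply/loc_predP; exists s, a; rewrite invf_div.
Qed.

Lemma ord_unit x : x != 0 -> x \in A -> x^-1 \in A -> ord p x = 0.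
Proof.
move=> x0 xA vA; have := ord_ge0 xA x0; have := ord_ge0 vA (invr_neq0 x0).
by rewrite ordV //; lia.
Qed.

Section OrdInjective.
Hypothesis ord0_loc : forall x, x != 0 -> ord p x = 0 -> x \in A.

(** Under the hypothesis on order 0, the nonzero elements of K modulo the units of A
    embed in the integers; t realizes the positive generator of the image. *)
Lemma ord_generator : exists t, [/\ t != 0, 0 < ord p t &
  forall x, x != 0 -> exists u n, [/\ u \in A, u != 0, u^-1 \in A & x = u * t ^ n]].
Proof.
(* the positive values of the order *)
pose V := [pred n : nat | `[< (0 < n)%N /\ exists2 x, x != 0 & ord p x = n%:Z >]].
have exV : exists n, V n.
  have [a ap a0] := maxSpec_nonzero; exists (L a); apply/asboolP.
  split; first by rewrite -ltz_nat -ord_tofrac // ord_tofrac_gt0.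
  by exists a%:F; [rewrite tofrac_eq0 | exact: ord_tofrac].
case: (ex_minnP exV) => d /asboolP[d0 [t t0 td]] dmin; exists t; split=> //.
  by rewrite td.
move=> x x0; pose n := (ord p x %/ d%:Z)%Z.
have ut0 : x / t ^ n != 0 by rewrite mulf_neq0 // invr_neq0 ?expfz_neq0.
have ordu : ord p (x / t ^ n) = (ord p x %% d%:Z)%Z.
  by rewrite ordM ?invr_neq0 ?expfz_neq0 // ordV ?expfz_neq0 // ord_exprz // td /modz mulrC.
have u0 : ord p (x / t ^ n) = 0.
  apply/eqP; rewrite ordu; apply: contraT => r0.
  have dn0 : d%:Z != 0 by lia.
  have := modz_ge0 (ord p x) dn0; have := ltz_pmod (ord p x) (d := d%:Z) d0.
  move: r0 ordu; case: (_ %% _)%Z => // r r0 ordu lt_rd _.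
  have : V r by apply/asboolP; split; [lia | exists (x / t ^ n)].
  by move/dmin; lia.
exists (x / t ^ n), n; rewrite ut0 loc_inv ?ord0_loc //; split=> //.
by rewrite divfK // expfz_neq0.
Qed.

End OrdInjective.
End Order.

(** * When the order determines elements up to local units *)

Section Valuation.
Local Open Scope ring_scope.

(** The numerical semigroup generated by j and j + 1 contains every n >= j * j: with
    n = q j + r and r < j <= q, write n = j (q - r) + (j + 1) r. *)
Lemma consecutive_powers (A : fieldType) (S : subringClosed A) (t : A) j :
  t ^+ j \in S -> t ^+ j.+1 \in S ->
  forall n, (j * j <= n)%N -> t ^+ n \in S.
Proof.
move=> tj tj1 n jn.
case: j => [|j] in tj tj1 jn *; first by rewrite -[n]mul1n exprM rpredX.
have lt_r : (n %% j.+1 < j.+1)%N by rewrite ltn_mod.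
have le_q : (j.+1 <= n %/ j.+1)%N by rewrite leq_divRL.
have -> : n = (j.+1 * (n %/ j.+1 - n %% j.+1) + j.+2 * (n %% j.+1))%N.
  by rewrite {1}(divn_eq n j.+1); nia.
by rewrite exprD !exprM; apply: rpredM; apply: rpredX.
Qed.

Variable O : idomainType.
Hypotheses (hdim : has_krull_dim O 1) (noethO : noetherian O).
Variable p : maxSpec O.
Local Notation K := {fraction O}.
Local Notation A := (loc_pred p).
Implicit Types x y : K.

Hypothesis ord0_loc : forall x, x != 0 -> ord p x = 0 -> x \in A.

Let ordM := ordM hdim noethO p.

(** Writing t = a/b, the powers of t associated to b and a have consecutive
    exponents, so all large powers of t lie in A. If all t^n with n > M lie in A, so
    does t^M: compare 1 + t with the unit multiple u t^k of a power of t. *)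
Lemma uniformizer_loc (t : K) : t != 0 -> 0 < ord p t ->
  (forall x, x != 0 -> exists u n, [/\ u \in A, u != 0, u^-1 \in A & x = u * t ^ n]) ->
  t \in A.
Proof.
move=> t0 ot tP.
have unit_cancel u x : u != 0 -> u^-1 \in A -> u * x \in A -> x \in A.
  by move=> u0 vA uxA; rewrite -[x](mulKf u0) rpredM.
have ordP u n : u \in A -> u != 0 -> u^-1 \in A -> ord p (u * t ^ n) = ord p t * n.
  move=> uA u0 vA; rewrite ordM ?expfz_neq0 // (ord_unit hdim noethO) // add0r.
  by rewrite (ord_exprz hdim noethO).
have [j tj tj1] : exists2 j, t ^+ j \in A & t ^+ j.+1 \in A.
  have [a [b [b0 tE]]] := fracP t.
  have a0 : a != 0 by apply: contraNneq t0 => a0; rewrite tE a0 rmorph0 mul0r.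
  have aF0 : a%:F != 0 :> K by rewrite tofrac_eq0.
  have bF0 : b%:F != 0 :> K by rewrite tofrac_eq0.
  have [u [i [uA u0 vA aE]]] := tP _ aF0.
  have [v [k [vA' v0 wA bE]]] := tP _ bF0.
  have oa := ord_ge0 hdim noethO (tofrac_loc p a) aF0; rewrite aE ordP // pmulr_rge0 // in oa.
  have ob := ord_ge0 hdim noethO (tofrac_loc p b) bF0; rewrite bE ordP // pmulr_rge0 // in ob.
  have ik : i = k + 1.
    have : ord p a%:F = ord p t + ord p b%:F by rewrite -ordM // tE divfK.
    rewrite aE bE !ordP // -{2}[ord p t]mulr1 -mulrDr addrC.
    by apply: mulfI; rewrite gt_eqF.
  case: k => // k in ob bE ik *; exists k.
    by apply: (unit_cancel v) => //; rewrite -[t ^+ k]/(t ^ Posz k) -bE tofrac_loc.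
  apply: (unit_cancel u) => //.
  by rewrite -[t ^+ _]/(t ^ Posz _) -addn1 PoszD -ik -aE tofrac_loc.
pose H := [pred N : nat | `[< forall n, (N <= n)%N -> t ^+ n \in A >]].
have exH : exists N, H N.
  by exists (j * j)%N; apply/asboolP; exact: consecutive_powers tj tj1.
case: (ex_minnP exH) => -[|M] /asboolP hM Mmin; first exact: (hM 1%N).
suff tM : t ^+ M \in A.
  suff : H M by move/Mmin; rewrite ltnn.
  by apply/asboolP => n; rewrite leq_eqVlt => /orP[/eqP<- //|]; exact: hM.
(* t = - 1 would have order 0, since its square is 1 *)
have t1 : 1 + t != 0.
  apply/eqP => t1; have tN : t = - 1 by apply/eqP; rewrite -addr_eq0 addrC t1.
  have := ordM t0 t0; rewrite {1 2}tN mulrNN mulr1 (ord_one hdim noethO); lia.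
have [u [[[|k]|k] [uA u0 vA tE]]] := tP _ t1.
- have tA : t \in A by rewrite -[t](addKr 1) tE expr0z mulr1 addrC rpredB ?rpred1.
  exact: rpredX.
- have -> : t ^+ M = u * t ^+ (M + k.+1) - t ^+ M.+1.
    by rewrite exprD mulrCA -[t ^+ k.+1]/(t ^ Posz k.+1) -tE exprSr; ring.
  by rewrite rpredB ?rpredM ?hM //; lia.
- apply: (unit_cancel u) => //.
  have -> : u * t ^+ M = t ^+ (M + k.+1) + t ^+ (M + k.+1).+1.
    transitivity (t ^+ (M + k.+1) * (1 + t)); last by rewrite mulrDr mulr1 -exprSr.
    by rewrite tE NegzE -exprnN exprD mulrCA mulfK // expf_neq0.
  by rewrite rpredD ?hM //; lia.
Qed.

Theorem ord_valuation x : x != 0 -> 0 <= ord p x -> x \in A.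
Proof.
move=> x0; have [t [t0 ot tP]] := ord_generator hdim noethO ord0_loc.
have tA := uniformizer_loc t0 ot tP.
have [u [n [uA u0 vA ->]]] := tP x x0.
rewrite ordM ?expfz_neq0 // (ord_unit hdim noethO) // add0r (ord_exprz hdim noethO) //.
rewrite pmulr_rge0 //; case: n => // n _; rewrite rpredM //.
exact: rpredX.
Qed.

(** If x had negative order, then 1/x would lie in A, and a monic equation for x
    divided by a power of x would express x as a polynomial in 1/x. *)
Lemma integral_loc x : x \in normalization O -> x \in A.
Proof.
move=> /asboolP[f fmon froot].
have [->|x0] := eqVneq x 0; first exact: rpred0.
have [/(ord_valuation x0)//|ox] := lerP 0 (ord p x).
have yA : x^-1 \in A.
  by apply: ord_valuation; rewrite ?invr_neq0 // (ordV hdim noethO) //; lia.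
pose n := (size f).-1.
have sf : size f = n.+1 by rewrite /n prednK // size_poly_gt0 monic_neq0.
have sfF : size (map_poly (@FracField.tofrac O) f) = n.+1.
  by rewrite size_map_inj_poly ?rmorph0 // => a b /eqP; rewrite tofrac_eq => /eqP.
have : \sum_(i < n) (f`_i)%:F * x ^+ i + x ^+ n = 0.
  move: froot; rewrite /root horner_coef sfF big_ord_recr /= => /eqP.
  have -> : (map_poly (@FracField.tofrac O) f)`_n = 1.
    by rewrite coef_map /= -[n]/(size f).-1 -lead_coefE (monicP fmon) rmorph1.
  rewrite mul1r => e; rewrite -[RHS]e; congr (_ + _).
  by apply: eq_bigr => i _; rewrite coef_map.
case: n {sf sfF} => [|n]; first by rewrite big_ord0 add0r expr0 => /eqP; rewrite oner_eq0.
move/eqP; rewrite addrC addr_eq0 => /eqP xE.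
have -> : x = - \sum_(i < n.+1) (f`_i)%:F * x^-1 ^+ (n - i).
  rewrite -[LHS](mulfK (expf_neq0 n x0)) -exprS xE mulNr mulr_suml; congr (- _).
  apply: eq_bigr => i _; rewrite -mulrA; congr (_ * _).
  have le_in : (i <= n)%N by rewrite -ltnS.
  by rewrite -{2}(subnK le_in) exprD invfM mulrCA mulfV ?expf_neq0 // mulr1 exprVn.
by rewrite rpredN rpred_sum // => i _; apply: rpredM; [exact: tofrac_loc | exact: rpredX].
Qed.

End Valuation.

(** * Fractional ideals and their localizations *)

Section FractionalIdeals.
Local Open Scope ring_scope.
Variable O : idomainType.
Local Notation K := {fraction O}.
Implicit Types (I J : {pred K}) (x y : K) (p : maxSpec O).

Lemma base_ringP x : reflect (exists a : O, x = a%:F) (x \in base_ring O).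
Proof. exact: asboolP. Qed.

Lemma base_ring_subring : subring_closed (base_ring O).
Proof.
split=> [|_ _ /base_ringP[a ->] /base_ringP[b ->]|_ _ /base_ringP[a ->] /base_ringP[b ->]];
  apply/base_ringP; first by exists 1; rewrite rmorph1.
  by exists (a - b); rewrite rmorphB.
by exists (a * b); rewrite rmorphM.
Qed.

HB.instance Definition _ :=
  GRing.isSubringClosed.Build K (base_ring O) base_ring_subring.

Lemma base_ring_normalization : {subset base_ring O <= normalization O}.
Proof. by move=> _ /base_ringP[a ->]; apply/asboolP; exact: integral_id. Qed.

Lemma fraction_scaleE (a : O) x : a *: x = a%:F * x. Proof. by []. Qed.

Lemma fracZM I a x : submod_closed I -> x \in I -> a%:F * x \in I.
Proof. by move=> cI xI; rewrite -fraction_scaleE submodZ. Qed.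

Lemma loc_idealP p I x :
  reflect (exists y s, [/\ y \in I, s \notin val p & x = y / s%:F]) (x \in loc_ideal p I).
Proof. exact: asboolP. Qed.

Lemma ideal_mulP I J x : reflect (exists n (u v : 'I_n -> K),
     [/\ forall i, u i \in I, forall i, v i \in J & x = \sum_i u i * v i])
  (x \in ideal_mul I J).
Proof. exact: asboolP. Qed.

Lemma mem_ideal_mul I J x y : x \in I -> y \in J -> x * y \in ideal_mul I J.
Proof.
move=> xI yJ; apply/ideal_mulP; exists 1%N, (fun=> x), (fun=> y).
by split=> //; rewrite big_ord1.
Qed.

Lemma ideal_mul_submod I J : submod_closed I -> submod_closed (ideal_mul I J).
Proof.
move=> cI; split.
  by apply/ideal_mulP; exists 0%N, (fun=> 0), (fun=> 0); split=> [[]|[]|] //; rewrite big_ord0.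
move=> a _ _ /ideal_mulP[n [u [v [uI vJ ->]]]] /ideal_mulP[m [u' [v' [uI' vJ' ->]]]].
apply/ideal_mulP; exists (n + m)%N.
exists (fun i => match split i with inl j => a%:F * u j | inr j => u' j end).
exists (fun i => match split i with inl j => v j | inr j => v' j end).
split=> [i|i|]; try by case: split.
  by case: split => // j; exact: fracZM.
rewrite big_split_ord /= [a *: _]mulr_sumr; congr (_ + _); apply: eq_bigr => i _.
  by rewrite (unsplitK (inl i)) mulrA.
by rewrite (unsplitK (inr i)).
Qed.

Definition ideal_in_frac (I : {pred O}) : {pred K} :=
  image_pred (@FracField.tofrac O : O^o -> K) I.

Lemma ideal_in_fracP (I : {pred O}) x :
  reflect (exists2 c, c \in I & x = c%:F) (x \in ideal_in_frac I).
Proof. exact: asboolP. Qed.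

Lemma ideal_in_frac_submod (I : {pred O}) : ideal I -> submod_closed (ideal_in_frac I).
Proof.
by apply: image_submod => c x y; rewrite rmorphD -[c *: x]/(c * x) rmorphM.
Qed.

(** Used both with S the complement of a maximal ideal and with S the set of nonzero
    elements. *)
Lemma common_denominator (S : O -> Prop) I n (v : 'I_n -> K) :
  submod_closed I -> S 1 -> (forall s t, S s -> S t -> S (s * t)) ->
  (forall i, exists2 s, S s & s%:F * v i \in I) ->
  exists2 s, S s & forall i, s%:F * v i \in I.
Proof.
move=> cI S1 SM; elim: n v => [|n IH] v h; first by exists 1 => // -[].
have [i|s Ss hs] := IH (fun i => v (fintype.lift ord0 i)); first exact: h.
have [t St ht] := h ord0; exists (s * t) => [|i]; first exact: SM.
have cl a b x : b%:F * x \in I -> (a * b)%:F * x \in I.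
  by rewrite rmorphM -mulrA; exact: fracZM.
by case: (unliftP ord0 i) => [j ->|->]; [rewrite [s * t]mulrC|]; exact: cl.
Qed.

Lemma base_ring_submod : @submod_closed O K (base_ring O).
Proof.
split=> [|a x y xR yR]; first exact: rpred0.
by apply: rpredD => //; apply: rpredM => //; apply/base_ringP; exists a.
Qed.

(** The condition under which [loc_generator] selects a value. *)
Definition generates p I x := x != 0 /\
  forall y, y \in loc_ideal p I <-> exists2 r, r \in loc_pred p & y = x * r.

Lemma generates_ratio p I x x' : generates p I x -> generates p I x' ->
  x / x' \in loc_pred p.
Proof.
move=> [x0 xP] [x0' xP'].
have /xP'[r rA ->] : x \in loc_ideal p I by apply/xP; exists 1; rewrite ?rpred1 ?mulr1.
by rewrite mulrC mulKf.
Qed.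

Lemma loc_generatorP p I x : generates p I x -> generates p I (loc_generator p I).
Proof. by move=> gx; rewrite /loc_generator; case: xgetP => [y _ //|/(_ x)]. Qed.

Section OneDim.
Hypotheses (hdim : has_krull_dim O 1) (noethO : noetherian O).

Lemma ord_loc_generator p I x : generates p I x -> ord p (loc_generator p I) = ord p x.
Proof.
move=> gx; have gy := loc_generatorP gx; have [x0 _] := gx; have [y0 _] := gy.
rewrite -[loc_generator p I](divfK x0) (ordM hdim noethO) ?mulf_neq0 ?invr_eq0 //.
rewrite (ord_unit hdim noethO) ?add0r ?mulf_neq0 ?invr_eq0 //.
  exact: generates_ratio gy gx.
by rewrite invf_div; exact: generates_ratio gx gy.
Qed.

(** The ideal of all r with r x in J is nonzero, and no maximal ideal contains it. *)
Lemma local_global J x : submod_closed J -> (exists2 j, j \in J & j != 0) ->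
  (forall p, x \in loc_ideal p J) -> x \in J.
Proof.
move=> cJ [j jJ j0] xJ; pose D : {pred O} := [pred r | r%:F * x \in J].
have cD : ideal D.
  split; first by rewrite inE rmorph0 mul0r (proj1 cJ).
  move=> a r s; rewrite !inE => rD sD; rewrite rmorphD rmorphM mulrDl -mulrA.
  by rewrite submodD // fracZM.
have [D1|D1] := boolP (1 \in D); first by move: D1; rewrite inE rmorph1 mul1r.
have [d dD d0] : exists2 d, d \in D & d != 0.
  have [a [b [b0 xE]]] := fracP x; have [c [e [e0 jE]]] := fracP j.
  have c0 : c != 0 by apply: contraNneq j0 => c0; rewrite jE c0 rmorph0 mul0r.
  exists (b * c); last exact: mulf_neq0.
  rewrite inE (_ : _ * x = (a * e)%:F * j) ?fracZM // xE jE.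
  have bF : b%:F != 0 :> K by rewrite tofrac_eq0.
  have eF : e%:F != 0 :> K by rewrite tofrac_eq0.
  transitivity (a%:F * c%:F : K); first by rewrite rmorphM mulrC mulrA divfK.
  by rewrite rmorphM -mulrA mulrC [e%:F * _]mulrC divfK // mulrC.
have [p Dp] := sub_maximal hdim noethO cD D1 dD d0.
have /loc_idealP[y [s [yJ sp xE]]] := xJ p.
have s0 := tofrac_neq0 sp.
by case/negP: sp; apply: Dp; rewrite inE xE mulrC divfK.
Qed.

(** * Invertible ideals supported at one maximal ideal *)

Section PrimaryPart.
Variables (p : maxSpec O) (a : O).
Hypothesis a0 : a != 0.

(** For nonzero a in p this is the p-primary component of aO; for a outside p it is O. *)
Definition primary : {pred O} := contraction (@loc_principal O p a).

Lemma primaryP c : reflect (c%:F / a%:F \in loc_pred p) (c \in primary).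
Proof.
have aF : a%:F != 0 :> K by rewrite tofrac_eq0.
apply: (iffP (loc_principalP a (to_loc p c))) => [[r /(congr1 val) /= ->]|h].
  by rewrite mulrC mulKf //; exact: valP.
exists (Localization h); apply: val_inj; rewrite loc_valM /= mulrC divfK //.
Qed.

Lemma primary_ideal : ideal primary.
Proof. by apply: contraction_ideal; exact: loc_principal_submod. Qed.

Lemma mem_primary : a \in primary.
Proof. by apply/primaryP; rewrite divff ?tofrac_eq0 ?rpred1. Qed.

(** Otherwise some prime of A contains a but no power of z; being nonzero, it contracts
    to p. *)
Lemma primary_radical z : z \in val p -> exists n, z ^+ n \in primary.
Proof.
move=> zp; apply: contrapT => nz.
have [||||P [pP aP SP]] := @prime_avoiding (localization p) (loc_noetherian noethO)
  (fun w : localization p => exists n, w = to_loc p (z ^+ n)) (@loc_principal O p a).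
- by exists 0%N; rewrite expr0 to_loc1.
- by move=> _ _ [n ->] [m ->]; exists (n + m)%N; rewrite exprD to_locM.
- exact: loc_principal_submod.
- by move=> _ [n ->]; apply/negP => h; apply: nz; exists n.
have aP' : to_loc p a \in P.
  by apply: aP; apply/loc_principalP; exists 1; rewrite mulr1.
have aL0 : to_loc p a != 0 by rewrite to_loc_eq0.
have : z \in contraction P by rewrite (loc_prime_contraction hdim noethO pP aP' aL0).
by rewrite inE; apply/negP; apply: SP; exists 1%N; rewrite expr1.
Qed.

Lemma primary_away q : q != p -> exists2 w, w \in primary & w \notin val q.
Proof.
move=> qp; have [cq q1] := maximal_idealI (maxSpecP q).
have [z zp zq] : exists2 z, z \in val p & z \notin val q.
  apply: contrapT => h; case/eqP: qp; apply: val_inj.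
  apply: (maximal_eq (maxSpecP p) cq q1) => z zp; apply: contrapT => /negP zq.
  by apply: h; exists z.
have [n zn] := primary_radical zp; exists (z ^+ n) => //.
elim: n {zn} => [|n IH]; first by rewrite expr0.
by rewrite exprS maxSpecM.
Qed.

Definition primaryF : {pred K} := ideal_in_frac primary.

Lemma primaryFP x : reflect (exists2 c, c \in primary & x = c%:F) (x \in primaryF).
Proof. exact: asboolP. Qed.

Lemma primaryF_submod : submod_closed primaryF.
Proof. exact: ideal_in_frac_submod primary_ideal. Qed.

Lemma primaryF_fractional : fractional_ideal primaryF.
Proof.
split; first exact: primaryF_submod.
  have [n [v [vI vP]]] := ideal_generators noethO primary_ideal.
  exists n, (fun i => (v i)%:F) => x; split=> [/primaryFP[c /vP[d ->] ->]|[d ->]].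
    by exists d; rewrite rmorph_sum; apply: eq_bigr => i _; rewrite rmorphM.
  apply: submod_sum primaryF_submod _ => i; apply: submodZ primaryF_submod _.
  by apply/primaryFP; exists (v i).
by exists a%:F; [apply/primaryFP; exists a => //; exact: mem_primary | rewrite tofrac_eq0].
Qed.

Lemma primaryF_generates : generates p primaryF a%:F.
Proof.
split=> [|y]; first by rewrite tofrac_eq0.
have aF : a%:F != 0 :> K by rewrite tofrac_eq0.
split=> [/loc_idealP[_ [s [/primaryFP[c /primaryP cA ->] sp ->]]]|[r /loc_predP[b [s [sp ->]]] ->]].
  exists (c%:F / a%:F / s%:F); last by rewrite mulrA [a%:F * _]mulrC divfK.
  by apply: rpredM => //; apply/loc_predP; exists 1, s; rewrite rmorph1 mul1r.
apply/loc_idealP; exists (b * a)%:F, s; split=> //; last by rewrite rmorphM mulrA [a%:F * _]mulrC.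
by apply/primaryFP; exists (b * a) => //; apply: (idealM _ primary_ideal); exact: mem_primary.
Qed.

Lemma primaryF_generates_away q : q != p -> generates q primaryF 1.
Proof.
move=> qp; split=> [|y]; first exact: oner_neq0.
have [w wI wq] := primary_away qp.
split=> [/loc_idealP[_ [s [/primaryFP[c cI ->] sq ->]]]|[r /loc_predP[b [s [sq ->]]] ->]].
  by exists (c%:F / s%:F); rewrite ?mul1r //; apply/loc_predP; exists c, s.
apply/loc_idealP; exists (b * w)%:F, (s * w); split.
- by apply/primaryFP; exists (b * w) => //; exact: (idealM _ primary_ideal).
- exact: maxSpecM.
by rewrite mul1r !rmorphM -mulf_div divff ?mulr1 ?(tofrac_neq0 wq).
Qed.

(** The inverse is J = O + (s/a) O, where s outside p clears the denominators of all
    c/a with c in the primary ideal; then the product lies in O. It contains the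
    primary ideal and s, which no maximal ideal contains simultaneously. *)
Lemma primaryF_invertible : invertible_ideal primaryF.
Proof.
have aF : a%:F != 0 :> K by rewrite tofrac_eq0.
split; first exact: primaryF_fractional.
have [n [v [vI vP]]] := ideal_generators noethO primary_ideal.
have [s sp sa] : exists2 s, s \notin val p &
    forall c, c \in primary -> s%:F * (c%:F / a%:F) \in base_ring O.
  have [||||s sp hs] := @common_denominator (fun s => s \notin val p) (base_ring O) n
      (fun i => (v i)%:F / a%:F).
  - exact: base_ring_submod.
  - exact: maxSpec1.
  - exact: maxSpecM.
  - move=> i; have /primaryP/loc_predP[b [s [sp ->]]] := vI i.
    by exists s => //; rewrite mulrC divfK ?(tofrac_neq0 sp) //; apply/base_ringP; exists b.
  exists s => // c /vP[d ->].
  rewrite rmorph_sum mulr_suml mulr_sumr rpred_sum // => i _.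
  rewrite rmorphM -mulrA mulrCA.
  by apply: rpredM; [apply/base_ringP; exists (d i) | exact: hs].
(* the inverse ideal O + (s/a) O *)
pose J : {pred K} := [pred y | `[< exists b c : O, y = b%:F + c%:F * (s%:F / a%:F) >]].
have JP y : reflect (exists b c : O, y = b%:F + c%:F * (s%:F / a%:F)) (y \in J) by exact: asboolP.
have J1 : 1 \in J by apply/JP; exists 1, 0; rewrite rmorph1 rmorph0 mul0r addr0.
exists J; split.
  split; last by exists 1; rewrite ?oner_neq0.
    split; first by apply/JP; exists 0, 0; rewrite !rmorph0 mul0r addr0.
    move=> d _ _ /JP[b [c ->]] /JP[b' [c' ->]]; apply/JP; exists (d * b + b'), (d * c + c').
    by rewrite fraction_scaleE !rmorphD !rmorphM mulrDr mulrDl mulrA addrACA.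
  exists 2%N, (fun i => if i == ord0 then 1 else s%:F / a%:F) => x; split.
    move=> /JP[b [c ->]]; exists (fun i => if i == ord0 then b else c).
    by rewrite !big_ord_recl big_ord0 /= addr0 !fraction_scaleE mulr1.
  move=> [c ->]; apply/JP; exists (c ord0), (c (fintype.lift ord0 ord0)).
  by rewrite !big_ord_recl big_ord0 /= addr0 !fraction_scaleE mulr1.
have cM := ideal_mul_submod J primaryF_submod.
pose W : {pred O} := [pred c | c%:F \in ideal_mul primaryF J].
have WE c : (c \in W) = (c%:F \in ideal_mul primaryF J) by [].
have cW : ideal W.
  split; first by rewrite WE rmorph0 (proj1 cM).
  by move=> d x y; rewrite !WE rmorphD rmorphM => xW yW; exact: (proj2 cM).
have IW : {subset primary <= W}.
  move=> c cI; rewrite WE -[c%:F]mulr1; apply: mem_ideal_mul => //.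
  by apply/primaryFP; exists c.
have sW : s \in W.
  rewrite WE -[s%:F](divfK aF) mulrC; apply: mem_ideal_mul.
    by apply/primaryFP; exists a => //; exact: mem_primary.
  by apply/JP; exists 0, 1; rewrite rmorph0 rmorph1 add0r mul1r.
have W1 : 1 \in W.
  apply: contraT => W1.
  have [q Wq] := sub_maximal hdim noethO cW W1 (IW _ mem_primary) a0.
  have [qp|qp] := eqVneq q p; first by case/negP: sp; rewrite -qp Wq.
  by have [w /IW/Wq wq] := primary_away qp; rewrite wq.
move=> x; apply/idP/base_ringP => [/ideal_mulP[m [u [w [uI wJ ->]]]]|[c ->]]; last first.
  exact: (ideal_whole c cW W1).
apply/base_ringP/rpred_sum => i _.
have /primaryFP[c cI ->] := uI i; have /JP[b [d ->]] := wJ i.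
have -> : c%:F * (b%:F + d%:F * (s%:F / a%:F)) =
  (c * b)%:F + d%:F * (s%:F * (c%:F / a%:F)).
  by rewrite rmorphM mulrDr mulrCA [c%:F * (s%:F / _)]mulrCA.
apply: rpredD; first by apply/base_ringP; exists (c * b).
by apply: rpredM; [apply/base_ringP; exists d | exact: sa].
Qed.

End PrimaryPart.

Lemma eq_div (I J : invIdeals O) :
  (forall q, ord q (loc_generator q (val I)) = ord q (loc_generator q (val J))) ->
  div I = div J.
Proof.
move=> e.
pose c (I : invIdeals O) (q : maxSpec O) : Div O :=
  << ord q (loc_generator q (val I)) *g q >>.
pose s (c : maxSpec O -> Div O) := \sum_(q \in [set: maxSpec O]%classic) c q.
have cE : c I = c J by apply: funext => q; rewrite /c e.
exact: (congr1 s cE).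
Qed.

(** Write x = a/b. The ideals obtained by contracting aA and bA to O have divisors
    ord_p(a) p and ord_p(b) p, hence coincide; so a lies in bA. *)
Lemma div_inj_ord p : injective (@div O) ->
  forall x, x != 0 -> ord p x = 0 -> x \in loc_pred p.
Proof.
move=> injdiv x; have [a [b [b0 ->]]] := fracP x.
rewrite mulf_eq0 negb_or tofrac_eq0 => /andP[a0 _] oab.
pose Ia : invIdeals O := exist _ (primaryF p a) (asboolT (primaryF_invertible p a0)).
pose Ib : invIdeals O := exist _ (primaryF p b) (asboolT (primaryF_invertible p b0)).
have /injdiv/(congr1 val) : div Ia = div Ib.
  apply: eq_div => q /=.
  have [->|qp] := eqVneq q p.
    rewrite (ord_loc_generator (primaryF_generates p a0)).
    rewrite (ord_loc_generator (primaryF_generates p b0)).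
    move/eqP: oab; rewrite (ordM hdim noethO) ?invr_eq0 ?tofrac_eq0 //.
    by rewrite (ordV hdim noethO) ?tofrac_eq0 // subr_eq0 => /eqP.
  rewrite (ord_loc_generator (primaryF_generates_away a0 qp)).
  by rewrite (ord_loc_generator (primaryF_generates_away b0 qp)).
move=> /= eI; have : a%:F \in primaryF p a.
  by apply/primaryFP; exists a => //; exact: mem_primary.
rewrite [primaryF p a]eI => /primaryFP[c /(primaryP _ b0) h /eqP].
by rewrite tofrac_eq => /eqP->.
Qed.

Lemma div_inj_normal : injective (@div O) -> base_ring O =i normalization O.
Proof.
move=> injdiv x; apply/idP/idP => [|xN]; first exact: base_ring_normalization.
apply: local_global base_ring_submod _ _ => [|p]; first by exists 1; rewrite ?rpred1 ?oner_neq0.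
have /loc_predP[a [s [sp ->]]] := integral_loc hdim noethO (div_inj_ord (p := p) injdiv) xN.
by apply/loc_idealP; exists a%:F, s; split=> //; apply/base_ringP; exists a.
Qed.

End OneDim.
End FractionalIdeals.

(** * Coefficients of divisors *)

Section FreeSums.
Local Open Scope ring_scope.

(** A sum over an infinite support would be 0 by convention, whence the hypothesis. *)
Lemma coeff_fsbig (T : choiceType) (f : T -> int) x :
  finite_set [set q | f q != 0]%classic ->
  coeff x (\sum_(q \in [set: T]%classic) << f q *g q >>) = f x.
Proof.
move=> /finite_seqP[s sE].
have fs q : q \notin s -> f q = 0.
  move=> qs; apply/eqP; apply: contraT => fq; move: qs.
  suff -> : q \in s by [].
  suff : [set` s]%classic q by [].
  by rewrite -sE.
rewrite (fsbigE (undup s)); first last.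
- by move=> q _; rewrite mem_undup => /fs->; rewrite freegU0.
- by [].
- exact: undup_uniq.
rewrite raddf_sum /=.
have cE q : coeff x << f q *g q >> = if q == x then f q else 0.
  by rewrite coeffU; case: eqP => _; rewrite ?mulr1 ?mulr0.
under eq_bigl => q do rewrite in_setT.
under eq_bigr => q _ do rewrite cE.
have [xs|xs] := boolP (x \in s).
  by rewrite (bigD1_seq x) ?mem_undup ?undup_uniq //= eqxx big1 ?addr0 // => q /negPf->.
rewrite big_seq big1 ?fs // => q; rewrite mem_undup; case: eqP => // ->.
by rewrite (negPf xs).
Qed.

End FreeSums.

(** * Orders over a normal ring *)

Section Normal.
Local Open Scope ring_scope.
Variable O : idomainType.
Local Notation K := {fraction O}.
Hypotheses (hdim : has_krull_dim O 1) (noethO : noetherian O).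
Implicit Types (I J : {pred K}) (x y : K) (p : maxSpec O).

(** The determinant trick: on generators of P, multiplication by z is a matrix over O,
    and z is an eigenvalue of it because the vector of generators is nonzero. *)
Lemma stable_integral (P : {pred O}) z : ideal P -> (exists2 c, c \in P & c != 0) ->
  (forall c, c \in P -> exists2 b, b \in P & c%:F * z = b%:F) ->
  z \in normalization O.
Proof.
move=> cP [c cP' c0] zP.
have [n [v [vI vP]]] := ideal_generators noethO cP.
have /choice[m mP] i : exists d : 'I_n -> O, (v i)%:F * z = \sum_j (d j)%:F * (v j)%:F.
  have [b /vP[d bE] ->] := zP _ (vI i); exists d; rewrite bE rmorph_sum.
  by apply: eq_bigr => j _; rewrite rmorphM.
(* transposed, since eigenvectors are row vectors *)
pose M : 'M[O]_n := \matrix_(i, j) m j i.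
apply/asboolP; exists (char_poly M); first exact: char_poly_monic.
rewrite map_char_poly -eigenvalue_root_char; apply/eigenvalueP.
exists (\row_i (v i)%:F).
  apply/rowP => i; rewrite !mxE mulrC mP; apply: eq_bigr => j _.
  by rewrite !mxE mulrC.
apply: contraNneq c0 => v0; have [d ->] := vP _ cP'.
rewrite big1 // => i _; have /rowP/(_ i) := v0; rewrite !mxE => /eqP.
by rewrite tofrac_eq0 => /eqP->; rewrite mulr0.
Qed.

Section AtPrime.
Variable p : maxSpec O.
Hypothesis normalO : base_ring O =i normalization O.
Local Notation A := (loc_pred p).
Local Notation L := (len_loc_quot p).

(** For a nonzero a in p, choose y outside the contraction of aA whose multiples by
    elements of p are in it, and put z = y/a: then z is not in A but zp is contained
    in A. If zp were contained in pA, a multiple of z by an element outside p would map p to itself and be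
    integral, hence in O, and z would be in A. So c z is a unit of A for some c in p,
    and c'/c is c'z times a unit for every c' in p. *)
Lemma uniformizer : exists c, [/\ c \in val p, c != 0 &
  forall c', c' \in val p -> c'%:F / c%:F \in A].
Proof.
have [a ap a0] := maxSpec_nonzero hdim p.
have aF : a%:F != 0 :> K by rewrite tofrac_eq0.
have [cp p1] := maximal_idealI (maxSpecP p).
have pI1 : 1 \notin primary p a.
  apply/negP => /(primaryP p a0) h.
  have := ord_ge0 hdim noethO h; rewrite rmorph1 mul1r invr_eq0 => /(_ aF).
  by rewrite (ordV hdim noethO) // oppr_ge0 leNgt (ord_tofrac_gt0 hdim noethO).
have [y yI pC] := prime_colon noethO (primary_ideal p a) pI1.
have [cC C1] := prime_idealI pC.
have pcolon : {subset val p <= colon (primary p a) y}.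
  move=> z /(primary_radical hdim noethO a0)[n zn].
  have : z ^+ n \in colon (primary p a) y by exact: (colon_sub y (primary_ideal p a)).
  elim: n {zn} => [|n IH]; first by rewrite expr0 (negPf C1).
  by rewrite exprS => /(pC.2)/orP[].
pose z : K := y%:F / a%:F.
have zA : z \notin A by apply: contra yI => /(primaryP p a0).
have pz c : c \in val p -> c%:F * z \in A.
  by move=> /pcolon /(primaryP p a0); rewrite rmorphM mulrA.
have [c cp' [b [s [bp sp czE]]]] : exists2 c, c \in val p & exists b s,
    [/\ b \notin val p, s \notin val p & c%:F * z = b%:F / s%:F].
  apply: contrapT => nc.
  have pzp c : c \in val p -> exists b s,
      [/\ b \in val p, s \notin val p & c%:F * z = b%:F / s%:F].
    move=> cp'; have /loc_predP[b [s [sp e]]] := pz c cp'; exists b, s; split=> //.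
    by apply: contraT => bp; case: nc; exists c => //; exists b, s.
  have [n [v [vI vP]]] := ideal_generators noethO cp.
  have [||||s sp hs] := @common_denominator O (fun s => s \notin val p)
      (ideal_in_frac (val p)) n (fun i => (v i)%:F * z).
  - exact: ideal_in_frac_submod.
  - exact: maxSpec1.
  - exact: maxSpecM.
  - move=> i; have [b [s [bp sp ->]]] := pzp _ (vI i); exists s => //.
    by apply/ideal_in_fracP; exists b; rewrite // mulrC divfK ?(tofrac_neq0 sp).
  have : s%:F * z \in normalization O.
    apply: (stable_integral cp) => [|c /vP[d ->]]; first by exists a.
    suff /ideal_in_fracP[b bp e] : (\sum_i d i * v i)%:F * (s%:F * z) \in ideal_in_frac (val p).
      by exists b.
    rewrite rmorph_sum mulr_suml; apply: submod_sum => [|i].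
      exact: ideal_in_frac_submod.
    rewrite rmorphM -mulrA [(v i)%:F * _]mulrCA; apply: fracZM => //.
    exact: ideal_in_frac_submod.
  rewrite -normalO => /base_ringP[b e]; case/negP: zA; apply/loc_predP; exists b, s.
  by split=> //; rewrite -e mulrC mulKf ?(tofrac_neq0 sp).
have z0 : z != 0 by apply: contraNneq zA => ->; exact: rpred0.
exists c; split=> // [|c' /pz c'z].
  apply/eqP => c0; move/eqP: czE; rewrite c0 rmorph0 mul0r eq_sym mulf_eq0 invr_eq0.
  by rewrite (negPf (tofrac_neq0 sp)) (negPf (tofrac_neq0 bp)).
have c0 : c%:F != 0 :> K.
  apply/eqP => c0; move/eqP: czE; rewrite c0 mul0r eq_sym mulf_eq0 invr_eq0.
  by rewrite (negPf (tofrac_neq0 sp)) (negPf (tofrac_neq0 bp)).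
have -> : c'%:F / c%:F = c'%:F * z * (s%:F / b%:F).
  have -> : s%:F / b%:F = z^-1 / c%:F by rewrite [RHS]mulrC -invfM czE invf_div.
  by rewrite mulrA mulfK.
by apply: rpredM => //; apply/loc_predP; exists s, b.
Qed.

(** Numerator and denominator of x have equal lengths. While these are positive, both
    lie in p and are divisible by c in A, and dividing lowers the two lengths by the
    same amount. *)
Lemma ord_eq0_loc x : x != 0 -> ord p x = 0 -> x \in A.
Proof.
have [c [cp c0 cP]] := uniformizer.
have cF : c%:F != 0 :> K by rewrite tofrac_eq0.
have lower a : a \in val p -> a != 0 -> exists a' s,
    [/\ s \notin val p, a' != 0, a%:F = c%:F * (a'%:F / s%:F) & (L a' < L a)%N /\ L a = (L c + L a')%N].
  move=> ap a0; have /loc_predP[a' [s [sp e]]] := cP a ap.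
  have aF : a%:F != 0 :> K by rewrite tofrac_eq0.
  have aE : a%:F = c%:F * (a'%:F / s%:F) by rewrite -e mulrC divfK.
  have s0 : s != 0 by rewrite -tofrac_eq0 (tofrac_neq0 sp).
  have a'0 : a' != 0.
    by apply: contraNneq aF => a'0; rewrite aE a'0 rmorph0 mul0r mulr0.
  have Ls : L s = 0%N by apply/eqP; rewrite (len_loc_quot_eq0 hdim noethO).
  have Lc : (0 < L c)%N by rewrite lt0n (len_loc_quot_eq0 hdim noethO) // negbK.
  have LE : L a = (L c + L a')%N.
    rewrite -(len_loc_quotM hdim noethO) // -[L a]addn0 -Ls -(len_loc_quotM hdim noethO) //.
    congr (L _); apply/eqP; rewrite -tofrac_eq [(a * s)%:F]rmorphM [(c * a')%:F]rmorphM /=.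
    by rewrite aE mulrA divfK ?(tofrac_neq0 sp).
  exists a', s; split=> //; split=> //.
  by rewrite LE -{1}[L a']add0n ltn_add2r.
suff gen n a b : (L a <= n)%N -> a != 0 -> b != 0 -> L a = L b -> a%:F / b%:F \in A.
  have [a [b [b0 ->]]] := fracP x.
  rewrite mulf_eq0 negb_or tofrac_eq0 => /andP[a0 _].
  by rewrite (ord_frac hdim noethO) // => /eqP; rewrite subr_eq0 => /eqP[/(gen _ a b (leqnn _))]; exact.
elim: n a b => [|n IH] a b an a0 b0 ab.
  apply/loc_predP; exists a, b; split=> //.
  by rewrite -(len_loc_quot_eq0 hdim noethO) // -ab -leqn0.
have [bp|bp] := boolP (b \in val p); last by apply/loc_predP; exists a, b.
have ap : a \in val p.
  by rewrite -[_ \in _]negbK -(len_loc_quot_eq0 hdim noethO) // ab (len_loc_quot_eq0 hdim noethO) // negbK.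
have [a' [s [sp a'0 -> [lt_a La]]]] := lower a ap a0.
have [b' [t [tp b'0 -> [lt_b Lb]]]] := lower b bp b0.
have -> : c%:F * (a'%:F / s%:F) / (c%:F * (b'%:F / t%:F)) = a'%:F / b'%:F * (t%:F / s%:F).
  by rewrite -mulf_div divff // mul1r invf_div !mulf_div [b'%:F * _]mulrC.
apply: rpredM; last by apply/loc_predP; exists t, s.
apply: IH => //; first by rewrite -ltnS; exact: leq_trans lt_a an.
by apply/eqP; rewrite -(eqn_add2l (L c)) -La -Lb ab.
Qed.

End AtPrime.

(** In a decomposition of 1 as a sum of products u_i v_i in O, some product is outside
    p, and the corresponding u_i generates: w = u_i (w v_i) / (u_i v_i). *)
Lemma invertible_generates p I : invertible_ideal I -> exists x, generates p I x.
Proof.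
move=> [[cI _ _] [J [_ IJ]]].
have prodO x y : x \in I -> y \in J -> exists b, x * y = b%:F.
  by move=> xI yJ; apply/base_ringP; rewrite -IJ mem_ideal_mul.
have /ideal_mulP[n [u [v [uI vJ E1]]]] : 1 \in ideal_mul I J by rewrite IJ rpred1.
have [i [b [bp uvE]]] : exists i b, b \notin val p /\ u i * v i = b%:F.
  apply: contrapT => nb; have [cp p1] := maximal_idealI (maxSpecP p).
  have : 1 \in ideal_in_frac (val p).
    rewrite E1; apply: submod_sum => [|i]; first exact: ideal_in_frac_submod.
    have [b e] := prodO _ _ (uI i) (vJ i); apply/ideal_in_fracP; exists b => //.
    by apply: contraT => bp; case: nb; exists i, b.
  move=> /ideal_in_fracP[b bp] /eqP; rewrite -(rmorph1 (@FracField.tofrac O)) tofrac_eq.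
  by move=> /eqP b1; move: p1; rewrite b1 bp.
have b0 := tofrac_neq0 bp.
have [u0 v0] : u i != 0 /\ v i != 0.
  by split; apply: contraNneq b0 => e; rewrite -uvE e ?mulr0 ?mul0r.
exists (u i); split=> // y; split=> [/loc_idealP[w [s [wI sp ->]]]|[r /loc_predP[c [s [sp ->]]] ->]].
  have [d wvE] := prodO _ _ wI (vJ i).
  exists (d%:F / (b * s)%:F); first by apply/loc_predP; exists d, (b * s); rewrite maxSpecM.
  have -> : w = u i * d%:F / b%:F by apply: (canRL (mulfK b0)); rewrite -wvE -uvE mulrCA.
  by rewrite rmorphM invfM !mulrA.
by apply/loc_idealP; exists (c%:F * u i), s; rewrite fracZM // mulrA [u i * _]mulrC.
Qed.

(** Let a be a nonzero element of I in O and d a common denominator of I. At a maximal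
    ideal that does not contain a d, the localization of I is the local ring itself. *)
Lemma finite_ord_generator I : fractional_ideal I ->
  finite_set [set p | ord p (loc_generator p I) != 0]%classic.
Proof.
move=> [cI [n [v vP]] [x xI x0]].
have [||||d d0 hd] := @common_denominator O (fun s => s != 0) (base_ring O) n v.
- exact: base_ring_submod.
- exact: oner_neq0.
- by move=> s t s0 t0; rewrite mulf_neq0.
- move=> i; have [a [b [b0 ->]]] := fracP (v i); exists b => //.
  by apply/base_ringP; exists a; rewrite mulrC divfK // tofrac_eq0.
have dI y : y \in I -> d%:F * y \in base_ring O.
  move=> /vP[c ->]; rewrite mulr_sumr rpred_sum // => i _.
  by rewrite fraction_scaleE mulrCA; apply: rpredM => //; apply/base_ringP; exists (c i).
have [a [b [b0 xE]]] := fracP x.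
have bF : b%:F != 0 :> K by rewrite tofrac_eq0.
have aI : a%:F \in I.
  have -> : a%:F = b%:F * x by rewrite xE mulrC divfK.
  exact: fracZM.
have a0 : a != 0 by apply: contraNneq x0 => a0; rewrite xE a0 rmorph0 mul0r.
have c0 : a * d != 0 by rewrite mulf_neq0.
have cD : ideal (adjoin (pred1 0) (a * d)).
  apply: adjoin_ideal; split; rewrite ?inE // => e u w.
  by rewrite !inE => /eqP-> /eqP->; rewrite scaler0 addr0.
have adD : a * d \in adjoin (pred1 0) (a * d).
  by apply/adjoinP; exists 0; rewrite ?inE //; exists 1; rewrite mul1r add0r.
have maxD P : prime_ideal P -> {subset adjoin (pred1 0) (a * d) <= P} -> maximal_ideal P.
  by move=> pP /(_ _ adD) adP; exact (nonzero_prime_maximal hdim noethO pP adP c0).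
apply: sub_finite_set (finite_maximal_over noethO maxD cD).
move=> p /=; apply: contraNP => nsub.
have ad : a * d \notin val p.
  apply/negP => adp; apply: nsub => y /adjoinP[z]; rewrite inE => /eqP-> [e ->].
  by rewrite add0r; apply: idealM adp; case: (maximal_idealI (maxSpecP p)).
have cp := (maximal_idealI (maxSpecP p)).1.
have ap : a \notin val p by apply: contra ad; rewrite mulrC; exact: idealM.
have dp : d \notin val p by apply: contra ad; exact: idealM.
suff g1 : generates p I 1 by rewrite (ord_loc_generator hdim noethO g1) ord_one.
split=> [|y]; first exact: oner_neq0.
split=> [/loc_idealP[w [s [wI sp ->]]]|[r /loc_predP[c [s [sp ->]]] ->]].
  exists (w / s%:F); rewrite ?mul1r //.
  have /base_ringP[e we] := dI w wI; apply/loc_predP; exists e, (d * s).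
  rewrite maxSpecM //; split=> //.
  by rewrite -we rmorphM -mulf_div divff ?mul1r ?(tofrac_neq0 dp).
apply/loc_idealP; exists (c%:F * a%:F), (s * a); rewrite maxSpecM // fracZM //; split=> //.
by rewrite mul1r rmorphM -mulf_div divff ?mulr1 ?(tofrac_neq0 ap).
Qed.

Lemma coeff_div (I : invIdeals O) p : coeff p (div I) = ord p (loc_generator p (val I)).
Proof.
have /asboolP[fI _] := valP I.
exact: (coeff_fsbig (f := fun q => ord q (loc_generator q (val I))) p (finite_ord_generator fI)).
Qed.

Lemma invertible_sub I J : base_ring O =i normalization O ->
  invertible_ideal I -> invertible_ideal J ->
  (forall p, ord p (loc_generator p I) = ord p (loc_generator p J)) -> {subset I <= J}.
Proof.
move=> normalO iI iJ oE x xI; have [[cJ _ neJ] _] := iJ.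
apply: (local_global hdim noethO cJ neJ) => p.
have [g /loc_generatorP[g0 gP]] := invertible_generates p iI.
have [h /loc_generatorP[h0 hP]] := invertible_generates p iJ.
apply/hP; have /gP[r rA ->] : x \in loc_ideal p I.
  by apply/loc_idealP; exists x, 1; split; rewrite ?maxSpec1 ?rmorph1 ?divr1.
exists (loc_generator p I / loc_generator p J * r); last first.
  by rewrite mulrA [_ * (_ / _)]mulrC divfK.
apply: rpredM rA; apply: (ord_eq0_loc normalO); first by rewrite mulf_neq0 ?invr_neq0.
by rewrite (ordM hdim noethO) ?invr_neq0 // (ordV hdim noethO) // oE subrr.
Qed.

Lemma normal_div_inj : base_ring O =i normalization O -> injective (@div O).
Proof.
move=> normalO I J e.
have /asboolP iI := valP I; have /asboolP iJ := valP J.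
have oE p : ord p (loc_generator p (val I)) = ord p (loc_generator p (val J)).
  by rewrite -!coeff_div e.
apply: val_inj; apply: (@subset_anti K); first exact: (invertible_sub normalO iI iJ oE).
by apply: (invertible_sub normalO iJ iI) => p; rewrite oE.
Qed.

End Normal.

Theorem theorem5p4 (O : idomainType) (hdim : has_krull_dim O 1)
    (hnoeth : noetherian O) (hfin : fin_gen (normalization O)) :
  injective (@div O) <-> base_ring O =i normalization O.
Proof.
by split; [exact: (div_inj_normal hdim hnoeth) | exact: (normal_div_inj hdim hnoeth)].
Qed.
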